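(* For each fixed $k\ge1$ and each $T<\infty$, $\sup_{t\in[0,T]}\left|\, e(G_k(t))/n-\tfrac12\int_0^t\rho_{k-1}(s)^2\,ds\,\right|\to0$ in probability as $n\to\infty$, where $e(G)$ denotes the number of edges of $G$.
   Context: Model: vertex set $[n]$. For each unordered pair $\{i,j\}$ of distinct vertices, edges between $i$ and $j$ arrive at the points of a Poisson process of rate $1/n$ on $(0,\infty)$, independently over pairs. $G_1(t)$ is the multigraph of all edges arrived by time $t$. Recursively: $F_k(t)$ is the subgraph of $G_k(t)$ of those edges which, at their arrival time $s\le t$, joined two different components of $G_k(s)$; $G_{k+1}(t):=G_k(t)\setminus F_k(t)$. For a graph $G$, $C_1(G)$ is the number of vertices in its largest component. For each $k\ge1$, $\rho_k:[0,\infty)\to[0,1]$ denotes the continuous function such that $C_1(G_k(t))/n\to\rho_k(t)$ in probability, uniformly in $t\ge0$ (its existence is a result of the same paper); and $\rho_0(t):=1$ for all $t$. *)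

(* Defs.v *)
From HB Require Import structures.
From mathcomp Require Import all_boot all_order all_algebra.
From mathcomp Require Import finmap.
From mathcomp Require Import all_classical all_reals all_analysis.
From Stdlib Require Import Relations.
Set Implicit Arguments. Unset Strict Implicit. Unset Printing Implicit Defensive.
Import Order.TTheory GRing.Theory Num.Theory.
Import numFieldNormedType.Exports.
Local Open Scope classical_set_scope.
Local Open Scope ring_scope.

(* Unordered pairs {i,j} of distinct vertices of [n] = 'I_n, represented as i < j. *)
Definition vpair (n : nat) := {p : 'I_n * 'I_n | (p.1 < p.2)%N}.

(* An edge slot: a pair together with the index m of the arrival
   (the (m+1)-th point of the Poisson process of that pair). *)
Definition edge (n : nat) := (vpair n * nat)%type.

Definition ends {n : nat} (e : edge n) : 'I_n * 'I_n := sval e.1.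

(* Arrival times from the inter-arrival gaps g: the m-th arrival of pair p
   is g(p,0) + ... + g(p,m). *)
Definition arrival {n : nat} {R : realType} (g : edge n -> R) (e : edge n) : R :=
  \sum_(k < e.2.+1) g (e.1, nat_of_ord k).

Definition connected {n : nat} (S : set (edge n)) (v w : 'I_n) : Prop :=
  clos_refl_trans 'I_n
    (fun a b => exists e, S e /\ ((ends e = (a, b)) \/ (ends e = (b, a)))) v w.

(* inGk j tau e : edge e (with arrival time tau e) belongs to G_{j+1}.
   G_1 = all edges; e in G_{k+1} iff e in G_k and e did NOT join two
   different components of G_k at its arrival time, i.e. its endpoints are
   already connected by edges of G_k that arrived strictly before e. *)
Fixpoint inGk {n : nat} {R : realType} (j : nat) (tau : edge n -> R)
    (e : edge n) : Prop :=
  match j with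
  | 0 => True
  | j'.+1 => inGk j' tau e /\
      connected [set e' | inGk j' tau e' /\ tau e' < tau e] (ends e).1 (ends e).2
  end.

Definition Gkt {n : nat} {R : realType} (k : nat) (tau : edge n -> R) (t : R)
  : set (edge n) := [set e | inGk k.-1 tau e /\ tau e <= t].

Definition C1 {n : nat} (S : set (edge n)) : nat :=
  \max_(v : 'I_n) #|[set w : 'I_n | `[< connected S v w >]]|.

Definition mutually_independent {d : measure_display} {T : measurableType d}
    {R : realType} (P : probability T R) {I : choiceType} (X : I -> T -> R) :=
  (forall i, measurable_fun setT (X i)) /\
  forall (J : {fset I}) (B : I -> set R), (forall i, measurable (B i)) ->
    P (\bigcap_(i in [set` J]) (X i @^-1` B i)) =
    (\prod_(i <- J) P (X i @^-1` B i))%E.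

Definition exponential_rv {d : measure_display} {T : measurableType d}
    {R : realType} (P : probability T R) (lam : R) (X : T -> R) :=
  forall x : R, 0 <= x -> P (X @^-1` `]x, +oo[) = (expR (- (lam * x)))%:E.

Definition outer_prob_to0 {R : realType} {d : nat -> measure_display}
    {Om : forall n, measurableType (d n)} (P : forall n, probability (Om n) R)
    (A : forall n, set (Om n)) :=
  forall delta : R, 0 < delta -> \forall n \near \oo,
    exists B : set (Om n), [/\ measurable B, A n `<=` B & P n B <= delta%:E]%E.

(* Main.v *)
Require Import Defs.
From HB Require Import structures.
From mathcomp Require Import all_boot all_order all_algebra.
From mathcomp Require Import finmap.
From mathcomp Require Import all_classical all_reals all_analysis.
From mathcomp Require Import ring lra zify.
From Stdlib Require Import Relations.
Import Order.TTheory GRing.Theory Num.Theory.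
Import numFieldNormedType.Exports.
Set Implicit Arguments. Unset Strict Implicit. Unset Printing Implicit Defensive.
Local Open Scope classical_set_scope.
Local Open Scope ring_scope.

(** The gaps are rounded to a fine grid: since [P (gap > c h) = exp (- h / n) ^ c],
    the rounded gaps are exactly geometric, so the rounded arrivals of all pairs
    form an array of i.i.d. Bernoulli bits.  For a mesh [h] of order [n ^ -6] the
    rounding preserves, with high probability, the order of all arrivals up to
    the horizon and hence the whole layer structure.

    In discrete time an edge arriving at a pair [p] belongs to layer [k] iff the
    ends of [p] are already connected in layer [k - 1], a predictable event.  So
    the number of edges of layer [k] minus its compensator is a martingale with
    variance [O(n)], and Chebyshev reduces the theorem to counting the connected
    pairs of layer [k - 1].  Their number is close to half the squared size of
    the largest component once there is no second component of linear size.
    This is proved by induction on the layer: if there were one, then (its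
    vertices and those of the giant being connected one layer below, by
    induction) the same martingale estimate forces an edge between the two within
    a short time, and the largest component would jump, against the continuity
    of [rho]. *)

(** * Predictable sums of independent bits *)

Section Bernoulli.
Context {R : realType} {I : finType}.
Variable q : R.
Hypothesis q01 : 0 <= q <= 1.
Implicit Types (z : {ffun I -> bool}) (f : {ffun I -> bool} -> R).

Definition bweight z : R := \prod_x (if z x then q else 1 - q).

Definition bexp f : R := \sum_z bweight z * f z.

Definition bprob (A : pred {ffun I -> bool}) : R := bexp (fun z => (A z)%:R).

Definition bflip (x : I) z : {ffun I -> bool} :=
  [ffun y => if y == x then ~~ z y else z y].

Lemma bflipK x : involutive (bflip x).
Proof.
move=> z; apply/ffunP => y; rewrite !ffunE.
by case: (y == x) => //; rewrite negbK.
Qed.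

Lemma bweight_ge0 z : 0 <= bweight z.
Proof.
by have /andP[q0 q1] := q01; apply: prodr_ge0 => x _; case: (z x); rewrite ?subr_ge0.
Qed.

Lemma bexpD f g : bexp (fun z => f z + g z) = bexp f + bexp g.
Proof.
by rewrite /bexp -big_split; apply: eq_bigr => z _; rewrite mulrDr.
Qed.

Lemma bexpZ a f : bexp (fun z => a * f z) = a * bexp f.
Proof.
by rewrite /bexp mulr_sumr; apply: eq_bigr => z _; rewrite mulrCA.
Qed.

Lemma bexp_sum (J : finType) (F : J -> {ffun I -> bool} -> R) :
  bexp (fun z => \sum_j F j z) = \sum_j bexp (F j).
Proof.
by rewrite /bexp exchange_big; apply: eq_bigr => z _; rewrite mulr_sumr.
Qed.

Lemma eq_bexp f g : f =1 g -> bexp f = bexp g.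
Proof. by move=> fg; apply: eq_bigr => z _; rewrite fg. Qed.

Lemma le_bexp f g : (forall z, f z <= g z) -> bexp f <= bexp g.
Proof.
by move=> fg; apply: ler_sum => z _; apply: ler_wpM2l; rewrite ?bweight_ge0.
Qed.

Lemma bexp_cst a : bexp (fun _ => a) = a.
Proof.
rewrite /bexp -mulr_suml /bweight.
rewrite -(bigA_distr_bigA (fun (_ : I) (b : bool) => if b then q else 1 - q)).
rewrite big1 ?mul1r// => x _; rewrite big_bool /=; ring.
Qed.

(** Flipping the bit [x] pairs the configurations. The weights of a pair differ only in the factor
    of [x], so the two terms are [q * (1 - q)] and [(1 - q) * (- q)] times a common value and
    cancel. *)
Lemma bexp_centered x f :
  (forall z, f (bflip x z) = f z) -> bexp (fun z => ((z x)%:R - q) * f z) = 0.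
Proof.
move=> fx; set F := fun z => bweight z * (((z x)%:R - q) * f z).
have bweightD z : bweight z = (if z x then q else 1 - q) *
    \prod_(y | y != x) (if z y then q else 1 - q).
  by rewrite /bweight (bigD1 x).
have Fflip z : F z + F (bflip x z) = 0.
  have fxx : bflip x z x = ~~ z x by rewrite ffunE eqxx.
  rewrite /F fx !bweightD fxx.
  rewrite [X in _ + _ * X * _](eq_bigr (fun y => if z y then q else 1 - q)); last first.
    by move=> y yx; rewrite ffunE (negbTE yx).
  by case: (z x) => /=; ring.
have : \sum_z F z + \sum_z F z = 0.
  rewrite {2}(reindex_inj (inv_inj (bflipK x))) /= -big_split /=.
  by rewrite big1.
rewrite /bexp -/F; set s := \sum_z F z => /eqP; rewrite -mulr2n mulrn_eq0 /=.
by move/eqP.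
Qed.

Lemma bexp_coord x : bexp (fun z => (z x)%:R) = q.
Proof.
have := @bexp_centered x (fun=> 1) (fun=> erefl).
rewrite (@eq_bexp _ (fun z => (z x)%:R + (- q))); last by move=> z; rewrite mulr1.
by rewrite bexpD bexp_cst => /eqP; rewrite subr_eq0 => /eqP.
Qed.

Lemma bexp_coord2 x y : x != y -> bexp (fun z => (z x)%:R * (z y)%:R) = q ^+ 2.
Proof.
move=> xy; have := @bexp_centered x (fun z => (z y)%:R) _.
rewrite (@eq_bexp _ (fun z => (z x)%:R * (z y)%:R + (- q) * (z y)%:R)); last first.
  by move=> z; rewrite mulrBl mulNr.
rewrite bexpD bexpZ bexp_coord => H.
have := H _; rewrite mulNr => /(_ _)/eqP; rewrite subr_eq0 => /(_ _)/eqP -> //.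
by move=> z; rewrite ffunE eq_sym (negbTE xy).
Qed.

Lemma le_bprob (A B : pred {ffun I -> bool}) :
  (forall z, A z -> B z) -> bprob A <= bprob B.
Proof.
by move=> AB; apply: le_bexp => z; rewrite ler_nat; case: (A z) (AB z) => // ->.
Qed.

Lemma bprob_exists (J : finType) (D : pred J) (A : J -> pred {ffun I -> bool}) :
  bprob (fun z => [exists j, D j && A j z]) <= \sum_(j | D j) bprob (A j).
Proof.
rewrite big_mkcond /=.
rewrite [leRHS](_ : _ = bexp (fun z => \sum_j (D j && A j z)%:R)); last first.
  rewrite bexp_sum; apply: eq_bigr => j _; case: (D j) => //=.
  by rewrite bexp_cst.
apply: le_bexp => z; case: existsP => [[j Aj]|_]; last by apply: sumr_ge0.
by rewrite (bigD1 j)//= Aj lerDl sumr_ge0.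
Qed.

Lemma bprobU (A B : pred {ffun I -> bool}) :
  bprob (fun z => A z || B z) <= bprob A + bprob B.
Proof.
rewrite /bprob -bexpD; apply: le_bexp => z.
by case: (A z); case: (B z); rewrite /= ?addr0 ?add0r ?lerDl.
Qed.

Lemma bprob_markov (a : R) f : 0 < a -> (forall z, 0 <= f z) ->
  bprob (fun z => a < f z) <= bexp f / a.
Proof.
move=> a0 f0; rewrite ler_pdivlMr// mulrC -bexpZ; apply: le_bexp => z.
by case: ltP => [/ltW|_]; rewrite ?mulr1 ?mulr0.
Qed.

Lemma bprob_count_gt (a : R) : 0 < a ->
  bprob (fun z => a < \sum_x (z x)%:R) <= #|I|%:R * q / a.
Proof.
move=> a0; apply: (le_trans (bprob_markov a0 _)) => [z|]; first exact: sumr_ge0.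
rewrite bexp_sum (eq_bigr (fun=> q)) => [|x _]; last exact: bexp_coord.
by rewrite sumr_const mulr_natl.
Qed.

(* Predictability of [c] makes the cross terms vanish. *)
Lemma bexp_martingale_sq (rank : I -> nat) (c : I -> {ffun I -> bool} -> bool) :
  (forall x y z, (rank y <= rank x)%N -> c y (bflip x z) = c y z) ->
  bexp (fun z => (\sum_x ((z x)%:R - q) * (c x z)%:R) ^+ 2) <= #|I|%:R * q.
Proof.
have /andP[q0 q1] := q01 => cP.
rewrite (@eq_bexp _ (fun z => \sum_x \sum_y
    (((z x)%:R - q) * (c x z)%:R) * (((z y)%:R - q) * (c y z)%:R))); last first.
  by move=> z; rewrite expr2 mulr_suml; apply: eq_bigr => x _; rewrite mulr_sumr.
rewrite bexp_sum mulrC mulr_natr -sumr_const; apply: ler_sum => x _.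
rewrite bexp_sum (bigD1 x)//= big1 ?addr0 => [|y yx].
  (* For a bit [b] one has [(b - q)^2 = (b - q) * (1 - 2 * q) + q * (1 - q)]; the first term has
     mean 0, which leaves a diagonal term of at most [q]. *)
  apply: (@le_trans _ _ (bexp (fun z => ((z x)%:R - q) * (1 - 2 * q) + q * (1 - q)))).
    apply: le_bexp => z; case: (z x); case: (c x z) => /=; nra.
  by rewrite bexpD bexp_cst bexp_centered//; nra.
(* Off the diagonal, the bit of larger rank is the one to centre: flipping it changes neither the
   other bit nor either of the two predictable factors. *)
wlog xy : x y yx / (rank y <= rank x)%N.
  move=> W; have [yx'|/ltnW xy] := leqP (rank y) (rank x); first exact: W.
  rewrite -(W y x) ?(eq_sym x)//; apply: eq_bexp => z; ring.
rewrite (@eq_bexp _ (fun z => ((z x)%:R - q) *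
   ((c x z)%:R * (((z y)%:R - q) * (c y z)%:R)))); last by move=> z; ring.
apply: bexp_centered => z; rewrite !cP//.
by rewrite ffunE (negbTE yx).
Qed.

Lemma bprob_martingale (rank : I -> nat) (c : I -> {ffun I -> bool} -> bool) (a : R) :
  0 < a ->
  (forall x y z, (rank y <= rank x)%N -> c y (bflip x z) = c y z) ->
  bprob (fun z => a < `|\sum_x ((z x)%:R - q) * (c x z)%:R|) <=
  #|I|%:R * q / a ^+ 2.
Proof.
move=> a0 cP; have a20 : 0 < a ^+ 2 by rewrite exprn_gt0.
apply: (@le_trans _ _ (bprob (fun z => a ^+ 2 <
    (\sum_x ((z x)%:R - q) * (c x z)%:R) ^+ 2))).
  apply: le_bprob => z; rewrite -(@real_normK _ (\sum_x _)) ?num_real// ltr_pXn2r ?nnegrE//.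
  exact: ltW.
apply: (le_trans (bprob_markov a20 _)) => [z|]; first exact: sqr_ge0.
by rewrite ler_pM2r ?invr_gt0//; exact: (bexp_martingale_sq cP).
Qed.

End Bernoulli.

(** * The layers in discrete time *)

Section DiscreteLayers.
Context {n N : nat}.
Implicit Types (z : {ffun 'I_N * vpair n -> bool}) (i j s : nat) (v w : 'I_n).

(** Turns counts over unordered pairs into double sums over vertices: each pair [i < j] stands for
    the two off-diagonal entries [(i, j)] and [(j, i)]. *)
Lemma sum_vpair (F : 'I_n -> 'I_n -> nat) :
  (\sum_(p : vpair n) (F (sval p).1 (sval p).2 + F (sval p).2 (sval p).1) =
   \sum_v \sum_(w | v != w) F v w)%N.
Proof.
have sumS (G : 'I_n * 'I_n -> nat) :
    (\sum_(p : vpair n) G (sval p) = \sum_(x : 'I_n * 'I_n | (x.1 < x.2)%N) G x)%N.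
  rewrite [RHS](reindex_omap (fun p : vpair n => sval p)
      (fun x : 'I_n * 'I_n => insub x : option (vpair n))) /=; last first.
    by move=> x xlt; rewrite insubT.
  apply: eq_bigl => -[p pP]; rewrite /= pP /= insubT /= .
  by apply/esym/eqP; congr Some; apply: val_inj.
rewrite big_split /= (sumS (fun x => F x.1 x.2)) (sumS (fun x => F x.2 x.1)).
rewrite pair_big_dep /=.
rewrite [RHS](bigID (fun x : 'I_n * 'I_n => (x.1 < x.2)%N)) /=.
congr (_ + _)%N.
  apply: eq_bigl => x; rewrite andb_idl// => xlt.
  by apply: contraTN xlt => /eqP ->; rewrite ltnn.
rewrite (reindex_inj (h := fun x : 'I_n * 'I_n => (x.2, x.1))) /=; last first.
  by move=> [a b] [c d] [-> ->].
by apply: eq_bigl => x; rewrite -leqNgt ltn_neqAle eq_sym.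
Qed.

Lemma card_vpair : (2 * #|{: vpair n}| = n * n - n)%N.
Proof.
have := sum_vpair (fun _ _ => 1%N); rewrite sum_nat_const mulnC => ->.
rewrite (eq_bigr (fun=> n.-1)) => [|v _].
  by rewrite sum_nat_const card_ord -subn1 mulnBr muln1.
rewrite sum1_card (eq_card (B := predC1 v)) => [|w]; last first.
  by rewrite !inE eq_sym.
by rewrite cardC1 card_ord.
Qed.

(* [dconn j z i] is connectivity in the j-th layer just before step [i], where
   [z (i, p)] says that an edge arrives at pair [p] at step [i]; layer [0] is
   the complete graph. *)
Fixpoint dconn j z i v w : Prop :=
  if j is j'.+1 then
    clos_refl_trans 'I_n (fun a b => exists x : 'I_N * vpair n,
      [/\ (x.1 < i)%N, z x, dconn j' z x.1 (sval x.2).1 (sval x.2).2 &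
          sval x.2 = (a, b) \/ sval x.2 = (b, a)]) v w
  else True.

Lemma dconn_refl j z i v : dconn j z i v v.
Proof. by case: j => [//|j]; apply: rt_refl. Qed.

Lemma dconn_sym j z i v w : dconn j z i v w -> dconn j z i w v.
Proof.
case: j => [//|j]; elim=> {v w} [a b [x [xi zx cx ab]]|a|a b c _ ba _ cb].
- by apply: rt_step; exists x; split=> //; case: ab; [right|left].
- exact: rt_refl.
- exact: rt_trans cb ba.
Qed.

Lemma dconn_trans j z i u v w : dconn j z i u v -> dconn j z i v w -> dconn j z i u w.
Proof. by case: j => [//|j]; apply: rt_trans. Qed.

Lemma dconn_step j z i (x : 'I_N * vpair n) : (x.1 < i)%N -> z x ->
  dconn j z x.1 (sval x.2).1 (sval x.2).2 ->
  dconn j.+1 z i (sval x.2).1 (sval x.2).2.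
Proof.
move=> xi zx cx; apply: rt_step; exists x; split=> //; left.
exact: surjective_pairing.
Qed.

Lemma dconn_mono j z i i' v w : (i <= i')%N -> dconn j z i v w -> dconn j z i' v w.
Proof.
move=> ii'; case: j => [//|j].
elim=> {v w} [a b [x [xi zx cx ab]]|a|a b c _ ba _ cb].
- by apply: rt_step; exists x; split=> //; exact: leq_trans ii'.
- exact: rt_refl.
- exact: rt_trans ba cb.
Qed.

Lemma dconn_nested j z i v w : dconn j.+1 z i v w -> dconn j z i v w.
Proof.
elim: j i v w => [//|j IH] i v w.
elim=> {v w} [a b [x [xi zx cx ab]]|a|a b c _ ba _ cb].
- by apply: rt_step; exists x; split=> //; exact: IH.
- exact: rt_refl.
- exact: rt_trans ba cb.
Qed.

(** This is the predictability that the martingale bound asks for: membership in a lower layer is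
    tested at the step of the edge itself, so the recursion never looks past step [i]. *)
Lemma dconn_local j z z' i v w : (forall x : 'I_N * vpair n, (x.1 < i)%N -> z x = z' x) ->
  dconn j z i v w -> dconn j z' i v w.
Proof.
elim: j i v w => [//|j IH] i v w zz'.
elim=> {v w} [a b [x [xi zx cx ab]]|a|a b c _ ba _ cb].
- apply: rt_step; exists x; split=> //; first by rewrite -zz'.
  by apply: IH cx => y yx; apply: zz'; exact: ltn_trans xi.
- exact: rt_refl.
- exact: rt_trans ba cb.
Qed.

(** * Components of the discrete layers, the giant and its rivals *)

Definition dcomp j z i v : {set 'I_n} := [set w | `[< dconn j z i v w >]]%SET.

Definition dC1 j z i : nat := (\max_v #|dcomp j z i v|)%N.

(** Ties are broken by [pick], which sees [z] only through the components just before step [i]; the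
    choice is therefore predictable as well. *)
Definition dgiant j z i : {set 'I_n} :=
  if [pick v | #|dcomp j z i v| == dC1 j z i] is Some v then dcomp j z i v else finset.set0.

(** The pairs where an arrival could merge a second large component into the giant. Both
    orientations occur because a pair is stored in increasing order. *)
Definition dcross j s z i (p : vpair n) : bool :=
  let U := [set v | (v \notin dgiant j z i) && (s <= #|dcomp j z i v|)%N]%SET in
  (((sval p).1 \in dgiant j z i) && ((sval p).2 \in U)) ||
  (((sval p).2 \in dgiant j z i) && ((sval p).1 \in U)).

Definition dpairs j z i : nat :=
  \sum_(p : vpair n) `[< dconn j z i (sval p).1 (sval p).2 >].

Definition duniq j s z i : Prop := forall v w,
  (s <= #|dcomp j z i v|)%N -> (s <= #|dcomp j z i w|)%N -> dconn j z i v w.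

Lemma in_dcomp j z i v w : (w \in dcomp j z i v) = `[< dconn j z i v w >].
Proof. by rewrite inE. Qed.

Lemma dcomp_refl j z i v : v \in dcomp j z i v.
Proof. by rewrite in_dcomp; apply/asboolP/dconn_refl. Qed.

Lemma dcomp_eq j z i v w : dconn j z i v w -> dcomp j z i v = dcomp j z i w.
Proof.
move=> vw; apply/finset.setP => u; rewrite !in_dcomp; apply/asboolP/asboolP.
  exact/dconn_trans/dconn_sym.
exact: dconn_trans.
Qed.

Lemma eq_dcomp j z z' i : (forall x : 'I_N * vpair n, (x.1 < i)%N -> z x = z' x) ->
  dcomp j z i = dcomp j z' i.
Proof.
move=> zz'; apply/funext => v; apply/finset.setP => w; rewrite !in_dcomp.
apply/asboolP/asboolP; apply: dconn_local => // x xi.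
by rewrite zz'.
Qed.

Lemma eq_dcross j s z z' i : (forall x : 'I_N * vpair n, (x.1 < i)%N -> z x = z' x) ->
  dcross j s z i = dcross j s z' i.
Proof.
by move=> zz'; rewrite /dcross /dgiant /dC1 (eq_dcomp j zz').
Qed.

Lemma leq_dC1 j z i v : (#|dcomp j z i v| <= dC1 j z i)%N.
Proof. exact: (@bigop.leq_bigmax _ (fun v => #|dcomp j z i v|) v). Qed.

Lemma dgiantP j z i : (0 < n)%N ->
  exists2 v, dgiant j z i = dcomp j z i v & #|dcomp j z i v| = dC1 j z i.
Proof.
move=> n0; rewrite /dgiant; case: pickP => [v /eqP vE|no]; first by exists v.
have [v vE] : {v | dC1 j z i = #|dcomp j z i v|}.
  by apply: bigop.eq_bigmax; rewrite card_ord.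
by have := no v; rewrite -vE eqxx.
Qed.

Lemma dcomp_nested j z i v : dcomp j.+1 z i v \subset dcomp j z i v.
Proof.
apply/fintype.subsetP => w; rewrite !in_dcomp => /asboolP vw.
exact/asboolP/dconn_nested.
Qed.

Lemma dcomp_mono j z i i' v : (i <= i')%N -> dcomp j z i v \subset dcomp j z i' v.
Proof.
move=> ii'; apply/fintype.subsetP => w; rewrite !in_dcomp => /asboolP vw.
by apply/asboolP; apply: dconn_mono vw.
Qed.

Lemma dpairs_mono j z i i' : (i <= i')%N -> (dpairs j z i <= dpairs j z i')%N.
Proof.
move=> ii'; apply: leq_sum => p _.
case: (asboolP (dconn j z i _ _)) => // /(dconn_mono ii') c.
by rewrite (asboolT c).
Qed.

(** Both sides count the ordered pairs of connected vertices, [n] being the contribution of the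
    diagonal. *)
Lemma dpairs_comp j z i : (2 * dpairs j z i + n = \sum_v #|dcomp j z i v|)%N.
Proof.
have := sum_vpair (fun v w => nat_of_bool `[< dconn j z i v w >]).
rewrite (eq_bigr (fun p : vpair n =>
    2 * `[< dconn j z i (sval p).1 (sval p).2 >])%N) => [|p _]; last first.
  rewrite mul2n -addnn; congr (_ + _)%N; congr nat_of_bool.
  by apply/asboolP/asboolP; apply: dconn_sym.
rewrite -big_distrr /= => ->.
rewrite -[X in (_ + X)%N](card_ord n) -sum1_card -big_split /=.
apply: eq_bigr => v _; rewrite [in RHS](cardD1 v) dcomp_refl addnC; congr (_ + _)%N.
rewrite -sum1_card [RHS]big_mkcond [LHS]big_mkcond; apply: eq_bigr => w _.
by rewrite !inE eq_sym; case: eqP => //= _; case: asboolP.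
Qed.

(** In the sum of [dpairs_comp], the vertices of the giant contribute the square of its size. By
    uniqueness any other vertex lies in a component smaller than [s], so the rest is at most
    [s * n]. *)
Lemma dpairs_bounds j s z i : (0 < n)%N -> duniq j s z i ->
  (dC1 j z i * dC1 j z i <= 2 * dpairs j z i + n <=
   dC1 j z i * dC1 j z i + s * n)%N.
Proof.
move=> n0 u; have [r gE rE] := dgiantP j z i n0.
rewrite dpairs_comp (bigID (mem (dcomp j z i r))) /=.
rewrite (eq_bigr (fun=> dC1 j z i)) => [|v]; last first.
  by rewrite in_dcomp => /asboolP /dcomp_eq <-.
rewrite sum_nat_const rE leq_addr leq_add2l /=.
apply: (@leq_trans (\sum_(v | v \notin dcomp j z i r) s)%N); last first.
  rewrite sum_nat_const mulnC leq_mul2l -[X in (_ <= X)%N](card_ord n).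
  by rewrite max_card orbT.
apply: leq_sum => v vr; rewrite leqNgt; apply: contra vr => /ltnW sv.
rewrite in_dcomp; apply/asboolP; apply: u => //.
by rewrite rE (leq_trans sv)// leq_dC1.
Qed.

(** The giant and the set [U] of vertices in rival components are disjoint and both have at least
    [s] elements, so their product injects into the crossing pairs. *)
Lemma dcross_count j s z i v : (0 < n)%N -> v \notin dgiant j z i ->
  (s <= #|dcomp j z i v|)%N -> (s * s <= \sum_(p : vpair n) dcross j s z i p)%N.
Proof.
move=> n0 vg sv; have [r gE rE] := dgiantP j z i n0.
set U := [set v | (v \notin dgiant j z i) && (s <= #|dcomp j z i v|)%N]%SET.
have vU : dcomp j z i v \subset U.
  apply/fintype.subsetP => w; rewrite in_dcomp => /asboolP vw; rewrite inE.
  rewrite -(dcomp_eq vw) sv andbT; apply: contra vg; rewrite gE !in_dcomp.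
  move=> /asboolP rw; apply/asboolP; exact: dconn_trans rw (dconn_sym vw).
apply: (@leq_trans (#|dgiant j z i| * #|U|)).
  apply: leq_mul; last exact: leq_trans (subset_leq_card vU).
  by rewrite gE rE (leq_trans sv)// leq_dC1.
have := sum_vpair (fun a b => (a \in dgiant j z i) && (b \in U) : nat).
rewrite [X in _ = X -> _](_ : _ = #|dgiant j z i| * #|U|)%N; last first.
  rewrite -sum_nat_const [RHS]big_mkcond; apply: eq_bigr => a _.
  case: ifP => ag /=; last by rewrite big1.
  rewrite -sum1_card [RHS]big_mkcond [LHS]big_mkcond; apply: eq_bigr => b _.
  by case: eqP => [<-|_]; rewrite ?inE ?ag//; case: (_ \in U).
move=> <-; apply: leq_sum => p _; rewrite /dcross -/U !inE.
by case: (_ \in dgiant j z i); case: (_ \in dgiant j z i); rewrite /= ?addn0 ?orbF.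
Qed.

(** Since its ends are connected one layer below, the arriving edge stays in layer [j.+1]. It joins
    two components disjoint at step [a], whose union lies in one component at step [b]. *)
Lemma dcross_jump j s z a b (x : 'I_N * vpair n) : (0 < n)%N -> (a <= x.1 < b)%N -> z x ->
  dcross j.+1 s z a x.2 -> dconn j z x.1 (sval x.2).1 (sval x.2).2 ->
  (dC1 j.+1 z a + s <= dC1 j.+1 z b)%N.
Proof.
move=> n0 /andP[ax xb] zx cx jx.
have [r gE rE] := dgiantP j.+1 z a n0.
have [g [u [gg ug su gu]]] : exists g u, [/\ g \in dgiant j.+1 z a,
    u \notin dgiant j.+1 z a, (s <= #|dcomp j.+1 z a u|)%N & dconn j.+1 z b g u].
  have cb := dconn_step xb zx jx.
  move: cx; rewrite /dcross !inE => /orP[]/and3P[gg ug su].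
    by exists (sval x.2).1, (sval x.2).2.
  by exists (sval x.2).2, (sval x.2).1; split=> //; exact: dconn_sym.
move: gg ug; rewrite gE !in_dcomp => /asboolP rg /asboolPn ru.
have ab : (a <= b)%N by apply: leq_trans ax (ltnW xb).
rewrite -rE; apply: (@leq_trans #|dcomp j.+1 z a r :|: dcomp j.+1 z a u|).
  rewrite cardsU [X in (_ - X)%N](_ : _ = 0)%N ?subn0 ?leq_add2l//.
  apply: eq_card0 => w; rewrite finset.in_setI !in_dcomp; apply/negbTE/negP.
  move=> /andP[/asboolP rw /asboolP uw]; apply: ru.
  exact: dconn_trans rw (dconn_sym uw).
apply: leq_trans (leq_dC1 _ _ _ r); apply: subset_leq_card.
rewrite finset.subUset dcomp_mono//= (@dcomp_eq j.+1 z b r u) ?dcomp_mono//.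
by apply: dconn_trans gu; apply: dconn_mono rg.
Qed.

(* A pair of [dcross] arriving in [[a, b)] would make the giant grow by [s]. *)
Lemma duniq_sprinkling j s z a b : (0 < n)%N -> duniq j s z a ->
  (dC1 j.+1 z b < dC1 j.+1 z a + s)%N ->
  ((s * s <= \sum_(p : vpair n) dcross j.+1 s z a p)%N ->
    exists x : 'I_N * vpair n, [/\ (a <= x.1 < b)%N, z x & dcross j.+1 s z a x.2]) ->
  duniq j.+1 s z a.
Proof.
move=> n0 uj lt cr; have [r gE rE] := dgiantP j.+1 z a n0.
suff inA v : (s <= #|dcomp j.+1 z a v|)%N -> dconn j.+1 z a r v.
  by move=> v w /inA rv /inA rw; apply: dconn_trans rw; exact: dconn_sym.
move=> sv; apply: contrapT => rv.
have vg : v \notin dgiant j.+1 z a by rewrite gE in_dcomp; apply/asboolPn.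
have [x [/andP[ax xb] zx cx]] := cr (dcross_count n0 vg sv).
have sg w : w \in dgiant j.+1 z a -> (s <= #|dcomp j z a w|)%N.
  rewrite gE in_dcomp => /asboolP rw.
  apply: leq_trans (subset_leq_card (dcomp_nested _ _ _ _)).
  by rewrite -(dcomp_eq rw) rE (leq_trans sv)// leq_dC1.
(* It remains to see that the edge belongs to layer [j.+1]. Components only grow when passing to
   layer [j], so both ends lie there in components of size at least [s], which coincide by
   uniqueness in layer [j]. *)
suff jx : dconn j z x.1 (sval x.2).1 (sval x.2).2.
  by move: lt; rewrite ltnNge (dcross_jump (x := x))// ax.
apply: (dconn_mono ax); move: cx; rewrite /dcross !inE.
move=> /orP[]/and3P[gg _ su]; [apply: uj|apply: uj] => //;
  try exact: sg; exact: leq_trans su (subset_leq_card (dcomp_nested _ _ _ _)).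
Qed.

End DiscreteLayers.

(** * Rounded exponential gaps *)

Section GapLaw.

(** Here [a k] counts the empty steps before the arrival [k]; the successor accounts for the step of
    the arrival, so that one pair never has two arrivals in a step. *)
Fixpoint arrival_step (a : nat -> nat) (m : nat) : nat :=
  if m is m'.+1 then (arrival_step a m' + (a m'.+1).+1)%N else a 0%N.

Definition hits (a : nat -> nat) (i : nat) : Prop := exists m, arrival_step a m = i.

(* The gap constraints, [(true, c)] for [a_k = c] and [(false, c)] for
   [c <= a_k], that encode a pattern [b] of arrivals preceded by [c] empty steps. *)
Fixpoint gap_constraints (c : nat) (b : seq bool) : seq (bool * nat) :=
  match b with
  | [::] => [:: (false, c)]
  | true :: b' => (true, c) :: gap_constraints 0 b'
  | false :: b' => gap_constraints c.+1 b'
  end.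

Definition gap_sat (u : bool * nat) (x : nat) : bool :=
  if u.1 then x == u.2 else (u.2 <= x)%N.

Lemma arrival_stepS a m :
  arrival_step a m.+1 = (a 0 + (arrival_step (a \o S) m).+1)%N.
Proof.
elim: m => [|m IH] /=; first by [].
by move: IH; rewrite /= => ->; rewrite -!addnA; congr (_ + _)%N; rewrite -addSn.
Qed.

Lemma arrival_step_ge a m : (a 0 <= arrival_step a m)%N.
Proof. by elim: m => // m IH /=; rewrite (leq_trans IH)// leq_addr. Qed.

Lemma hitsS a i : hits a (a 0 + i.+1)%N <-> hits (a \o S) i.
Proof.
split=> [[[|m]]|[m <-]]; last by exists m.+1; rewrite arrival_stepS.
  by move=> /= /eqP; rewrite -{1}[a 0%N]addn0 eqn_add2l.
by rewrite arrival_stepS => /addnI [<-]; exists m.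
Qed.

(** Induction on the pattern: an empty step increases [c], and an arrival fixes the current gap and
    restarts the process by [hitsS]. The default [(false, 0)] is satisfied by every gap, so past the
    list nothing is imposed. *)
Lemma gap_constraintsP c b a :
  ((c <= a 0)%N /\ forall i, (i < size b)%N -> (hits a (c + i) <-> nth false b i)) <->
  (forall k, gap_sat (nth (false, 0%N) (gap_constraints c b) k) (a k)).
Proof.
elim: b c a => [|[] b IH] c a /=.
- split=> [[ca _] [|[|k]]|H]; rewrite ?nth_nil//.
  by split=> //; exact: (H 0%N).
- split=> [[ca H]|H].
    have a0 : a 0%N = c.
      have [_ /(_ isT) [m mE]] := H 0%N (ltn0Sn _).
      apply/eqP; rewrite eqn_leq ca andbT -[X in (_ <= X)%N]addn0 -mE.
      exact: arrival_step_ge.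
    case=> [|k]; first exact/eqP.
    apply: ((IH 0%N (a \o S)).1 _ k); split=> // i ib.
    by rewrite add0n -hitsS a0; exact: (H i.+1).
  have /eqP a0 := H 0%N; rewrite a0; split=> // -[|i] ib.
    by rewrite addn0; split=> // _; exists 0%N.
  have [_ /(_ i ib)] := (IH 0%N (a \o S)).2 (fun k => H k.+1).
  by rewrite add0n -hitsS a0.
- rewrite -IH; split=> [[ca H]|[ca H]].
    have ca' : (c < a 0)%N.
      rewrite ltn_neqAle ca andbT; apply/eqP => c0.
      have [/(_ _)H0 _] := H 0%N (ltn0Sn _).
      by have : false by apply: H0; exists 0%N; rewrite addn0.
    split=> // i ib; rewrite addSnnS; exact: (H i.+1).
  split=> [|[|i] ib]; first exact: ltnW.
    split=> // -[m mE]; have := arrival_step_ge a m.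
    by rewrite mE addn0 leqNgt ca.
  by rewrite -addSnnS; apply: H.
Qed.

Lemma size_gap_constraints c b : (size (gap_constraints c b) <= (size b).+1)%N.
Proof. by elim: b c => [|[] b IH] c //=; rewrite ?ltnS// ltnW ?ltnS. Qed.

Context {R : realType}.

Definition gap_prob (q : R) (u : bool * nat) : R :=
  (1 - q) ^+ u.2 * (if u.1 then q else 1).

(** Geometric gaps amount to independent steps: each empty step costs [1 - q] and each arrival [q],
    whichever gap it belongs to. Indices past the list contribute the factor 1. *)
Lemma prod_gap_constraints q c b K : (size b <= K)%N ->
  \prod_(k < K.+1) gap_prob q (nth (false, 0%N) (gap_constraints c b) k) =
  (1 - q) ^+ c * \prod_(x <- b) (if x then q else 1 - q).
Proof.
elim: b c K => [|[] b IH] c K /= bK.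
- rewrite big_ord_recl /= big1 ?big_nil// => [|i _].
    by rewrite /gap_prob /= !mulr1.
  by rewrite /= nth_nil /gap_prob /= expr0 mulr1.
- case: K bK => // K bK; rewrite big_ord_recl big_cons /=.
  rewrite (eq_bigr (fun k : 'I_K.+1 => gap_prob q
     (nth (false, 0%N) (gap_constraints 0 b) k))) => [|k _ //].
  by rewrite IH// expr0 mul1r /gap_prob /= mulrA.
- by rewrite IH 1?ltnW// big_cons exprSr mulrA.
Qed.

(* Rounding by ceiling makes [c <= gap_steps h x] the event [c * h < x], whose
   probability is what the exponential law provides; nonpositive [x] get [0]. *)
Definition gap_steps (h x : R) : nat :=
  if 0 < x then (`|Num.ceil (x / h)|%N).-1 else 0%N.

Lemma leq_gap_steps h x c : 0 < h ->
  (c <= gap_steps h x)%N = (c == 0%N) || (c%:R * h < x).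
Proof.
move=> h0; case: c => [//|c]; rewrite /gap_steps /=; case: ifP => [x0|/negbT].
  have xh : 0 < x / h by rewrite divr_gt0.
  have := ceil_gt_int (x / h) c.+1%:Z.
  rewrite ltr_pdivlMr// => <-.
  have : 0 < Num.ceil (x / h) by rewrite ceil_gt0.
  by case: (Num.ceil _) => // -[//|m] _; rewrite absz_nat /= ltz_nat ltnS.
by rewrite -leNgt => x0; apply/esym/negbTE; rewrite -leNgt (le_trans x0)// mulr_ge0// ltW.
Qed.

Lemma gap_steps_bounds h x : 0 < h -> 0 < x ->
  (gap_steps h x)%:R * h < x <= (gap_steps h x).+1%:R * h.
Proof.
move=> h0 x0; apply/andP; split; last first.
  have := leq_gap_steps x (gap_steps h x).+1 h0.
  by rewrite ltnn /= => /esym/negbT; rewrite -leNgt.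
have := leq_gap_steps x (gap_steps h x) h0; rewrite leqnn => /esym/orP[/eqP ->|//].
by rewrite mul0r.
Qed.

Context {d : measure_display} {T : measurableType d} (P : probability T R).

Definition arrival_bits (n N : nat) (h : R) (X : edge n -> T -> R) (om : T) :
    {ffun 'I_N * vpair n -> bool} :=
  [ffun x : 'I_N * vpair n => `[< hits (fun k => gap_steps h (X (x.2, k) om)) x.1 >]].

Let cell (h : R) (u : bool * nat) : set R := [set x | gap_sat u (gap_steps h x)].

Lemma gap_cell_ge (h : R) (c : nat) : 0 < h ->
  [set x | (c <= gap_steps h x)%N] = if c == 0%N then setT else [set` `]c%:R * h, +oo[].
Proof.
move=> h0; apply/seteqP; split=> x /=; rewrite leq_gap_steps//;
  by case: eqP => //= _; rewrite in_itv/= andbT.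
Qed.

Lemma gap_cell_eq (h : R) (c : nat) :
  [set x | gap_steps h x == c] =
  [set x | (c <= gap_steps h x)%N] `\` [set x | (c.+1 <= gap_steps h x)%N].
Proof.
apply/seteqP; split=> x /=; first by move=> /eqP ->; rewrite leqnn ltnn.
by move=> [cx /negP]; rewrite -leqNgt eqn_leq cx => ->.
Qed.

Lemma measurable_gap_ge (h : R) (c : nat) : 0 < h ->
  measurable [set x : R | (c <= gap_steps h x)%N].
Proof. by move=> h0; rewrite gap_cell_ge//; case: eqP => _; [exact: measurableT|exact: measurable_itv]. Qed.

Lemma measurable_gap_cell (h : R) u : 0 < h -> measurable (cell h u).
Proof.
case: u => -[] c h0; rewrite /cell /gap_sat /=; last exact: measurable_gap_ge.
by rewrite gap_cell_eq; apply: measurableD; exact: measurable_gap_ge.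
Qed.

(** Exactness of the geometric tail is the exponential identity at the mesh points. The case [c = 0]
    is separate because the event is then sure, also for nonpositive gaps. *)
Lemma prob_gap_ge (lam h : R) (Y : T -> R) c : 0 < h -> exponential_rv P lam Y ->
  P (Y @^-1` [set x | (c <= gap_steps h x)%N]) = (expR (- (lam * h)) ^+ c)%:E.
Proof.
move=> h0 Yexp; rewrite gap_cell_ge//; case: eqP => [->|_].
  by rewrite preimage_setT probability_setT expr0.
rewrite Yexp; last by rewrite mulr_ge0// ltW.
rewrite -expRM_natl; congr (expR _)%:E.
by rewrite mulrN mulrCA.
Qed.

Lemma prob_gap_cell (lam h : R) (Y : T -> R) u : 0 < h ->
  measurable_fun setT Y -> exponential_rv P lam Y ->
  P (Y @^-1` cell h u) = (gap_prob (1 - expR (- (lam * h))) u)%:E.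
Proof.
case: u => -[] c h0 mY Yexp; rewrite /cell /gap_prob /gap_sat /= subKr; last first.
  by rewrite mulr1 (prob_gap_ge _ h0 Yexp).
have mYc c' : measurable (Y @^-1` [set x | (c' <= gap_steps h x)%N]).
  by rewrite -[X in measurable X]setTI; apply: mY => //; exact: measurable_gap_ge.
have PY c' := @prob_gap_ge lam h Y c' h0 Yexp.
transitivity (P ((Y @^-1` [set x | (c <= gap_steps h x)%N]) `\`
                 (Y @^-1` [set x | (c.+1 <= gap_steps h x)%N]))).
  by rewrite gap_cell_eq.
rewrite measureD; [|exact: mYc|exact: mYc|exact: (le_lt_trans (probability_le1 P (mYc c)) (ltry 1))].
rewrite (_ : _ `&` _ = Y @^-1` [set x | (c.+1 <= gap_steps h x)%N]).
  transitivity ((expR (- (lam * h)) ^+ c)%:E - (expR (- (lam * h)) ^+ c.+1)%:E)%E.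
    by congr (_ - _)%E; exact: PY.
  by rewrite -EFinB exprSr mulrBr mulr1.
by apply: setIidr => x; exact: ltnW.
Qed.

(** * Joint law of the arrival bits *)

Variables (n N : nat) (h lam : R) (X : edge n -> T -> R).
Hypothesis h0 : 0 < h.
Hypothesis Xind : mutually_independent P X.
Hypothesis Xexp : forall e, exponential_rv P lam (X e).

Let Z := arrival_bits N h X.
Let q := 1 - expR (- (lam * h)).
Let constr (z : {ffun 'I_N * vpair n -> bool}) (e : edge n) : set R :=
  cell h (nth (false, 0%N) (gap_constraints 0 [seq z (i, e.1) | i <- enum 'I_N]) e.2).
Let slots : {fset edge n} :=
  [fset e in [seq (p, k) | p <- index_enum {: vpair n}, k <- iota 0 N.+1]]%fset.

(** [N] steps of one pair give at most [N.+1] gap constraints, so finitely many gaps decide all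
    bits. This makes an outcome a finite intersection of independent events. *)
Lemma arrival_bitsE z : Z @^-1` [set z] = \bigcap_(e in [set` slots]) (X e @^-1` constr z e).
Proof.
have patP p om : (forall i, Z om (i, p) = z (i, p)) <->
    forall k, constr z (p, k) (X (p, k) om).
  rewrite /constr /cell /= -(@gap_constraintsP 0 _ (fun k => gap_steps h (X (p, k) om))).
  rewrite size_map size_enum_ord; split=> [H|[_ H] i].
    split=> // i iN; rewrite add0n (nth_map (Ordinal iN)) ?size_enum_ord//.
    have -> : nth (Ordinal iN) (enum 'I_N) i = Ordinal iN.
      by apply: val_inj; rewrite /= nth_enum_ord.
    by rewrite -H ffunE; split=> /asboolP.
  rewrite ffunE /=; have := H i (ltn_ord i).
  rewrite add0n (nth_map i) ?size_enum_ord// nth_ord_enum => iz.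
  by apply/idP/idP => [/asboolP/iz|/iz/asboolP].
apply/seteqP; split=> om /=.
  by move=> Zz [p k] _; apply: (patP p om).1 => i; rewrite Zz.
move=> H; apply/ffunP => -[i p]; move: i; apply: (patP p om).2 => k.
have [kN|Nk] := ltnP k N.+1.
  apply: H; rewrite /= inE; apply/allpairsP.
  by exists (p, k); rewrite mem_index_enum mem_iota.
rewrite /constr /cell /= nth_default//.
by rewrite (leq_trans (size_gap_constraints _ _))// size_map size_enum_ord.
Qed.

(** Independence gives a product over all gaps; grouped by pairs and regrouped by steps, it becomes
    the weight of i.i.d. Bernoulli bits. *)
Lemma prob_arrival_bits z : P (Z @^-1` [set z]) = (bweight q z)%:E.
Proof.
rewrite arrival_bitsE Xind.2 => [|e]; last exact: measurable_gap_cell.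
rewrite (eq_bigr (fun e => (gap_prob q (nth (false, 0%N)
   (gap_constraints 0 [seq z (i, e.1) | i <- enum 'I_N]) e.2))%:E)) => [|e _]; last first.
  exact: (prob_gap_cell _ h0 (Xind.1 e) (Xexp e)).
rewrite prodEFin; congr EFin.
have -> : \prod_(e <- slots) gap_prob q (nth (false, 0%N)
   (gap_constraints 0 [seq z (i, e.1) | i <- enum 'I_N]) e.2) =
   \prod_(e <- [seq (p, k) | p <- index_enum {: vpair n}, k <- iota 0 N.+1])
   gap_prob q (nth (false, 0%N)
   (gap_constraints 0 [seq z (i, e.1) | i <- enum 'I_N]) e.2).
  apply: perm_big; apply: uniq_perm; first exact: fset_uniq.
    apply: allpairs_uniq; rewrite ?index_enum_uniq ?iota_uniq//.
    by move=> [a b] [c e] _ _ [-> ->].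
  by move=> e; rewrite inE.
rewrite big_allpairs_dep /bweight.
transitivity (\prod_p \prod_(i < N) (if z (i, p) then q else 1 - q)); last first.
  rewrite exchange_big pair_big /=; apply: eq_bigr => -[i p] _ //.
apply: eq_bigr => p _ /=.
rewrite (_ : 0%N :: iota 1 N = index_iota 0 N.+1); last by rewrite /index_iota subn0.
rewrite big_mkord prod_gap_constraints.
  by rewrite expr0 mul1r big_map big_enum.
by rewrite size_map size_enum_ord.
Qed.

Lemma measurable_arrival_bits (A : pred {ffun 'I_N * vpair n -> bool}) :
  measurable (Z @^-1` [set` A]).
Proof.
rewrite (_ : _ @^-1` _ = \bigcup_(z in [set` A]) (Z @^-1` [set z])); last first.
  by apply/seteqP; split=> [om /= AZ|om /= [z Az Zz]]; [exists (Z om)|rewrite Zz].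
apply: fin_bigcup_measurable => // z _; rewrite arrival_bitsE.
apply: fin_bigcap_measurable => [|e _]; first exact: finite_fset.
by rewrite -[X in measurable X]setTI; apply: Xind.1 => //; exact: measurable_gap_cell.
Qed.

Lemma prob_arrival_bits_le (A : pred {ffun 'I_N * vpair n -> bool}) :
  (P (Z @^-1` [set` A]) <= (bprob q A)%:E)%E.
Proof.
apply: le_trans (content_sub_fsum (D := [set` A]) (A_ := fun z => Z @^-1` [set z]) _ _ _ _ _) _.
- exact: finite_finset.
- move=> z _; rewrite -(_ : [set` pred1 z] = [set z]); first exact: measurable_arrival_bits.
  by apply/seteqP; split=> y /=; rewrite inE => /eqP.
- exact: measurable_arrival_bits.
- by move=> om AZ; exists (Z om).
rewrite (eq_fsbigr (fun z => (bweight q z)%:E)) => [|z _]; last exact: prob_arrival_bits.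
rewrite fsbig_finite//= sumEFin lee_fin /bprob /bexp.
rewrite [leRHS](eq_bigr (fun z => if z \in A then bweight q z else 0)) => [|z _]; last first.
  by rewrite -[z \in A]/(A z); case: (A z); rewrite ?mulr1 ?mulr0.
rewrite -big_mkcond /= -big_enum /= (perm_big (enum A))//.
apply: uniq_perm; rewrite ?fset_uniq ?enum_uniq// => z.
by rewrite in_fset_set ?mem_enum ?mem_setE//; exact: finite_finset.
Qed.

End GapLaw.

(** * Coupling of the continuous and discrete layers *)

Section Coupling.
Context {R : realType} {n N M H r : nat}.
Variables (h : R) (g : edge n -> R).
Hypothesis h0 : 0 < h.
Hypothesis g0 : forall e, 0 < g e.

Let tau := arrival g.

Definition slot_step (e : edge n) : nat :=
  arrival_step (fun k => gap_steps h (g (e.1, k))) e.2.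

Let z : {ffun 'I_N * vpair n -> bool} :=
  [ffun x : 'I_N * vpair n => `[< hits (fun k => gap_steps h (g (x.2, k))) x.1 >]].

Hypothesis NE : N = (r * H + M)%N.
Hypothesis z_count : (\sum_x z x <= M)%N.
Hypothesis z_far : forall x y : 'I_N * vpair n, z x -> z y -> x != y ->
  (x.1 <= y.1)%N -> (x.1 + M < y.1)%N.
Hypothesis z_grid : forall (x : 'I_N * vpair n) l, z x -> (l <= r)%N ->
  (l * H <= x.1)%N -> (l * H + M <= x.1)%N.

(** Each gap is rounded separately by at most one step, so the errors add up with the index of the
    arrival. Bounding the indices by [M] and separating the bits by more than [M] therefore protects
    the order. *)
Lemma slot_step_bounds e :
  (slot_step e)%:R * h < tau e + e.2%:R * h /\ tau e <= (slot_step e).+1%:R * h.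
Proof.
case: e => p m; rewrite /slot_step /tau /arrival /=.
elim: m => [|m [IH1 IH2]].
  rewrite big_ord_recl big_ord0 /= addr0 mul0r addr0.
  by have /andP[] := gap_steps_bounds h0 (g0 (p, 0%N)).
rewrite big_ord_recr /= -!natr1 !natrD -natr1.
have /andP[] := gap_steps_bounds h0 (g0 (p, m.+1)).
move: IH1 IH2; rewrite -!natr1; set s := \sum_(i < _) _; set a := arrival_step _ _.
by move=> *; split; lra.
Qed.

Lemma tau_mono p m m' : (m <= m')%N -> tau (p, m) <= tau (p, m').
Proof.
move=> /subnK <-; elim: (m' - m)%N => [|k IH]; first by rewrite add0n.
apply: le_trans IH _; rewrite /tau /arrival addSn /= [leRHS]big_ord_recr /=.
by rewrite lerDl ltW.
Qed.

Lemma slot_step_lt p m m' : (m < m')%N -> (slot_step (p, m) < slot_step (p, m'))%N.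
Proof.
move=> /subnK <-; elim: (m' - m.+1)%N => [|k IH].
  by rewrite add0n /slot_step /= addnS ltnS leq_addr.
apply: leq_trans IH _; rewrite addSn /slot_step /=.
by rewrite leq_addr.
Qed.

Lemma slot_step_inj e e' : e.1 = e'.1 -> slot_step e = slot_step e' -> e = e'.
Proof.
case: e e' => [p m] [_ m'] /= <- E; congr (_, _).
by have [/(slot_step_lt p)|/(slot_step_lt p)|//] := ltngtP m m'; rewrite E ltnn.
Qed.

Lemma z_slot e (eN : (slot_step e < N)%N) : z (Ordinal eN, e.1).
Proof. by rewrite ffunE; apply/asboolP; exists e.2. Qed.

Lemma z_slotP (x : 'I_N * vpair n) : z x -> exists e, e.1 = x.2 /\ slot_step e = x.1.
Proof. by rewrite ffunE => /asboolP[m mE]; exists (x.2, m). Qed.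

(** The arrivals of this pair up to [e] occupy [e.2.+1] distinct set bits, and there are at most [M]
    of those. *)
Lemma slot_index e : (slot_step e < N)%N -> (e.2 < M)%N.
Proof.
case: e => p m eN; apply: leq_trans z_count.
have lt (k : 'I_m.+1) : (slot_step (p, nat_of_ord k) < N)%N.
  apply: leq_ltn_trans eN; have := ltn_ord k; rewrite ltnS leq_eqVlt.
  by move=> /orP[/eqP ->//|/(slot_step_lt p)/ltnW].
pose f (k : 'I_m.+1) := (Ordinal (lt k), p).
have finj : injective f.
  move=> k k' [E]; apply: val_inj.
  by case: (slot_step_inj (e := (p, nat_of_ord k)) (e' := (p, nat_of_ord k')) erefl E).
rewrite -[X in (X <= _)%N](card_ord m.+1) -(card_imset _ finj) -sum1_card big_mkcond.
apply: leq_sum => x _; case: imsetP => // -[k _ ->].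
by rewrite /f (z_slot (lt k)).
Qed.

Lemma slot_grid e l : (l <= r)%N -> (l * H <= slot_step e)%N -> (slot_step e < N)%N ->
  (l * H + M <= slot_step e)%N.
Proof. by move=> lr le eN; exact: (z_grid (z_slot eN)). Qed.

(** The last [M] steps are a buffer: by [z_grid] at [l = r] no bit is set between [r * H] and
    [N]. *)
Lemma slot_small e : (slot_step e < N)%N = (slot_step e < r * H)%N.
Proof.
apply/idP/idP => [eN|]; last by rewrite NE => /leq_trans; apply; rewrite leq_addr.
rewrite ltnNge; apply/negP => le.
by have := slot_grid (leqnn r) le eN; rewrite leqNgt -NE eN.
Qed.

Lemma le_tau_grid e l : (l <= r)%N ->
  (tau e <= (l * H)%:R * h) = (slot_step e < l * H)%N.
Proof.
move=> lr; have [b1 b2] := slot_step_bounds e; have := h0 => h0'.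
apply/idP/idP => [le|lt]; last first.
  by rewrite (le_trans b2)// ler_pM2r// ler_nat.
rewrite ltnNge; apply/negP => ge.
have lrH : (l * H <= r * H)%N by rewrite leq_mul2r lr orbT.
have [eN|Ne] := ltnP (slot_step e) N.
  have := slot_grid lr ge eN; have := slot_index eN => i1 i2.
  have : (l * H + e.2)%:R * h <= (slot_step e)%:R * h.
    by rewrite ler_pM2r// ler_nat (leq_trans _ i2)// leq_add2l ltnW.
  by rewrite natrD; lra.
(* Beyond [N] the index of [e] is not controlled. The first arrival of the same pair beyond [N] has
   index at most [M], because its predecessor falls below [N]; it already lies past the grid time,
   and [e] comes no earlier. *)
have exm : exists m, (N <= slot_step (e.1, m))%N by exists e.2; case: (e) Ne.
pose m := ex_minn exm; have mM : (m <= M)%N /\ (m <= e.2)%N /\ (N <= slot_step (e.1, m))%N.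
  rewrite /m; case: ex_minnP => -[|k] kN kmin; split=> //.
    by apply: (@slot_index (e.1, k)); rewrite ltnNge; apply/negP => /kmin; rewrite ltnn.
  by split=> //; apply: kmin; case: (e) Ne.
have [mM1 [mM2 mN]] := mM.
have [c1 _] := slot_step_bounds (e.1, m).
have : tau (e.1, m) <= tau e by case: (e) mM2 => p k; exact: tau_mono.
have : (l * H + m)%:R * h <= (slot_step (e.1, m))%:R * h.
  by rewrite ler_pM2r// ler_nat (leq_trans _ mN)// NE leq_add.
by move: c1; rewrite natrD /=; lra.
Qed.

(** Distinct set bits in order are more than [M] steps apart, which exceeds the rounding error, as
    the index of [e'] is below [M]. *)
Lemma lt_tau_step e e' : (slot_step e < N)%N -> (slot_step e' < N)%N ->
  (slot_step e < slot_step e')%N -> tau e < tau e'.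
Proof.
move=> eN eN' lt; have [_ b2] := slot_step_bounds e; have [c1 _] := slot_step_bounds e'.
have far : (slot_step e + M < slot_step e')%N.
  apply: (z_far (z_slot eN) (z_slot eN')); last exact: ltnW.
  by apply/eqP => -[E _]; rewrite E ltnn in lt.
have i' := slot_index eN'.
have : ((slot_step e).+1 + e'.2)%:R * h <= (slot_step e')%:R * h.
  rewrite ler_pM2r// ler_nat (leq_trans _ far)// addSn ltnS leq_add2l.
  exact: ltnW.
by rewrite natrD; lra.
Qed.

Lemma ltr_tau e e' : (slot_step e < N)%N -> (slot_step e' < N)%N ->
  (tau e < tau e') = (slot_step e < slot_step e')%N.
Proof.
move=> eN eN'; apply/idP/idP => [lt|]; last exact: lt_tau_step.
have [//|ge] := ltnP (slot_step e) (slot_step e').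
have [ee|ne] := eqVneq (Ordinal eN', e'.1) (Ordinal eN, e.1).
  case: ee => E1 E2; move: lt; rewrite (slot_step_inj E2 E1) ltxx//.
have far := z_far (z_slot eN') (z_slot eN) ne ge.
have := lt_tau_step eN' eN (leq_ltn_trans (leq_addr _ _) far).
by move=> /(lt_trans lt); rewrite ltxx.
Qed.

Lemma connected_dconn j i (S : set (edge n)) v w : (i <= N)%N ->
  (forall e, S e <-> (slot_step e < i)%N /\
                     dconn j z (slot_step e) (ends e).1 (ends e).2) ->
  Defs.connected S v w <-> dconn j.+1 z i v w.
Proof.
move=> iN SE; split.
  elim=> {v w} [a b [e [/SE[ei ce] ab]]|a|a b c _ ba _ cb].
  - apply: rt_step; exists (Ordinal (leq_trans ei iN), e.1).
    by split=> //; exact: z_slot.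
  - exact: rt_refl.
  - exact: rt_trans ba cb.
elim=> {v w} [a b [x [xi zx cx ab]]|a|a b c _ ba _ cb].
- have [e [e1 e2]] := z_slotP zx.
  apply: rt_step; exists e; rewrite /ends e1; split=> //.
  by apply/SE; rewrite /ends e1 e2.
- exact: rt_refl.
- exact: rt_trans ba cb.
Qed.

(** Induction on the layer: rounding keeps the strict order of arrivals below [N], so the edges
    present just before [e] are the same in both models. *)
Lemma inGk_dconn j e : (slot_step e < N)%N ->
  inGk j tau e <-> dconn j z (slot_step e) (ends e).1 (ends e).2.
Proof.
elim: j e => [//|j IH] e eN /=.
have CE : Defs.connected [set e' | inGk j tau e' /\ tau e' < tau e] (ends e).1 (ends e).2 <->
    dconn j.+1 z (slot_step e) (ends e).1 (ends e).2.
  apply: connected_dconn; first exact: ltnW.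
  (* An edge earlier than [e] must be shown to lie below [N] before orders can be compared; this
     follows since [e] arrives before the horizon, which is itself a grid time. *)
  move=> e' /=; split=> [[ge' lt]|[lt ce']].
    have eN' : (slot_step e' < N)%N.
      rewrite slot_small -le_tau_grid// (le_trans (ltW lt))//.
      by rewrite le_tau_grid// -slot_small.
    by rewrite -ltr_tau//; split=> //; exact/IH.
  have eN' := ltn_trans lt eN.
  by rewrite ltr_tau//; split=> //; exact/IH.
split=> [[_ /CE//]|ce]; split; last exact/CE.
by apply/IH => //; exact: dconn_nested ce.
Qed.

Lemma in_Gkt_grid k l e : (l <= r)%N ->
  Gkt k tau ((l * H)%:R * h) e <->
  (slot_step e < l * H)%N /\ dconn k.-1 z (slot_step e) (ends e).1 (ends e).2.
Proof.
move=> lr; rewrite /Gkt /= le_tau_grid//.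
have lN e' : (slot_step e' < l * H)%N -> (slot_step e' < N)%N.
  by rewrite slot_small => /leq_trans; apply; rewrite leq_mul2r lr orbT.
by split=> [[ge lt]|[lt ge]]; split=> //; apply/inGk_dconn => //; exact: lN.
Qed.

Lemma C1_grid k l : (0 < k)%N -> (l <= r)%N ->
  C1 (Gkt k tau ((l * H)%:R * h)) = dC1 k z (l * H).
Proof.
case: k => // k _ lr; rewrite /C1 /dC1; apply: eq_bigr => v _; apply: eq_card => w.
rewrite [RHS]inE.
have lN : (l * H <= N)%N by rewrite NE (leq_trans _ (leq_addr _ _))// leq_mul2r lr orbT.
have /= := @connected_dconn k _ _ v w lN (fun e => in_Gkt_grid k.+1 e lr).
move=> E; apply/idP/idP => [/set_mem /= /asboolP/E/asboolP//|/asboolP/E vw].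
by apply/mem_set/asboolP.
Qed.

Lemma card_grid k l : (l <= r)%N ->
  let G := Gkt k tau ((l * H)%:R * h) in
  finite_set G /\ #|` fset_set G| =
    (\sum_(x : 'I_N * vpair n) ((x.1 < l * H)%N && z x &&
      `[< dconn k.-1 z x.1 (sval x.2).1 (sval x.2).2 >]))%N.
Proof.
move=> lr G.
pose D := [set x : 'I_N * vpair n | (x.1 < l * H)%N && z x &&
   `[< dconn k.-1 z x.1 (sval x.2).1 (sval x.2).2 >]]%SET.
(* A set bit comes from exactly one slot, by [slot_step_inj]; [F] recovers it, with [xget] choosing
   the arrival index. *)
pose F (x : 'I_N * vpair n) : edge n :=
  (x.2, xget 0%N [set m | slot_step (x.2, m) = x.1]).
have FE x : z x -> slot_step (F x) = x.1.
  move=> zx; have [[p m] [/= e1 e2]] := z_slotP zx.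
  by rewrite /F; case: xgetP => [y _ //|/(_ m) []]; rewrite -e1.
have GE : G = [set` [fset F x | x in D]%fset].
  apply/seteqP; split=> [e /(in_Gkt_grid _ _ lr)[lt ce]|e].
    have eN : (slot_step e < N)%N.
      by rewrite slot_small (leq_trans lt)// leq_mul2r lr orbT.
    apply/imfsetP; exists (Ordinal eN, e.1) => /=.
      by rewrite inE /= lt (z_slot eN); apply/asboolP.
    by apply: slot_step_inj; rewrite ?FE//; exact: z_slot.
  move=> /imfsetP[x /=]; rewrite inE => /andP[/andP[xl zx] /asboolP cx ->].
  by apply/(in_Gkt_grid _ _ lr); rewrite FE.
split; first by rewrite GE; exact: finite_fset.
rewrite GE set_fsetK card_in_imfset /=; last first.
  move=> x y; rewrite !inE => /andP[/andP[_ zx] _] /andP[/andP[_ zy] _] E.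
  have := FE x zx; rewrite E FE// => E1; case: E => E2 _.
  by case: x y E1 E2 {zx zy} => [i p] [i' p'] /= /val_inj -> ->.
rewrite -cardE -sum1_card big_mkcond.
by apply: eq_bigr => x _; rewrite inE; case: (_ && _).
Qed.

End Coupling.

(** * Continuous functions on the half-line *)

Section Analysis.
Context {R : realType}.
Implicit Types (f : R -> R) (s t : R).

(** The theorem of Heine and Cantor: near each [s] continuity holds with some radius [e], and points
    and increments below [e / 2] stay within it; compactness of the segment makes the increment
    uniform. *)
Lemma uniform_continuity_segment f (T w : R) : 0 < w ->
  {within `[0, +oo[, continuous f} ->
  exists2 del, 0 < del & forall s t, 0 <= s <= T -> 0 <= t <= T ->
    `|s - t| <= del -> `|f s - f t| < w.
Proof.
move=> w0 cf.
move/subspace_continuousP in cf.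
have /compact_near_coveringP nc : compact (`[0, T]%classic : set R).
  exact: segment_compact.
pose Q (e s : R) := forall t, 0 <= t -> `|s - t| <= e -> 0 <= s -> `|f s - f t| < w.
have : \forall e \near 0^'+, `[0, T]%classic `<=` Q e.
  apply: nc => s; rewrite /= in_itv/= => /andP[s0 sT].
  have w20 : 0 < w / 2 by rewrite divr_gt0.
  have := cf s; rewrite /= in_itv/= andbT => /(_ s0) /cvgrPdist_lt /(_ _ w20) [e /= e0 eP].
  have e20 : 0 < e / 2 by rewrite divr_gt0.
  have fP u : 0 <= u -> `|s - u| < e -> `|f s - f u| < w / 2.
    by move=> u0 su; apply: eP => //; rewrite /= in_itv/= andbT.
  exists (ball s (e / 2), [set d | d < e / 2]).
    by split; [exact: nbhsx_ballx|exact: nbhs_right_lt].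
  case=> s' d [/= ss' de] t t0 s't s'0.
  rewrite -(subrKA (f s)) (le_lt_trans (ler_normD _ _))// (splitr w) ltrD//.
    by rewrite distrC fP// (lt_le_trans ss')//; lra.
  apply: fP => //; rewrite -(subrKA s') (le_lt_trans (ler_normD _ _))//.
  by rewrite (splitr e) ltr_leD// (le_trans s't)// ltW.
move=> H; have FF : ProperFilter ((0 : R)^'+) by exact: at_right_proper_filter.
have /(@filter_ex _ _ FF)[e [He e0]] :
    \forall e \near 0^'+, (`[0, T]%classic `<=` Q e) /\ 0 < e.
  by apply: filterI => //; exact: nbhs_right_gt.
exists e => // s t s0T /andP[t0 tT] st; apply: (He s) => //=.
by case/andP: s0T.
Qed.

Lemma integral_increment f s t lo hi : {within `[0, +oo[, continuous f} ->
  0 <= s -> s <= t -> (forall u, s <= u <= t -> lo <= f u <= hi) ->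
  lo * (t - s) <= \int[lebesgue_measure]_(u in `[0, t]) f u -
                  \int[lebesgue_measure]_(u in `[0, s]) f u <= hi * (t - s).
Proof.
move=> cf s0 st lohi.
have intf (u : R) : 0 <= u ->
    lebesgue_measure.-integrable `[0, u] (EFin \o f).
  move=> u0; apply: continuous_compact_integrable; first exact: segment_compact.
  apply: continuous_subspaceW cf => x /=; rewrite !in_itv/= andbT.
  by case/andP.
have t0 := le_trans s0 st.
rewrite Rintegral_itvB ?bnd_simp//; last exact: intf.
have intst : lebesgue_measure.-integrable `]s, t] (EFin \o f).
  apply: integrableS (intf t t0) => // x /=; rewrite !in_itv/= => /andP[sx ->].
  by rewrite (le_trans s0 (ltW sx)).
have intc (c : R) : lebesgue_measure.-integrable `]s, t] (EFin \o cst c).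
  apply: measurable_bounded_integrable => //=.
  - by rewrite lebesgue_measure_itv/=; case: ifP => _; rewrite ?ltry.
  - by exists `|c|; split; rewrite ?num_real// => M cM x _ /=; exact: ltW.
have cstE (c : R) : \int[lebesgue_measure]_(u in `]s, t]) c = c * (t - s).
  rewrite Rintegral_cst//.
  transitivity (c * fine (if s < t then (t - s)%:E else 0%E)).
    congr (_ * fine _); apply: (etrans (lebesgue_measure_itv _)).
    by rewrite /= lte_fin.
  by have [] := ltrgtP s t => [||->]; rewrite ?subrr//=; move: st; lra.
rewrite -!cstE; apply/andP; split.
  apply: le_Rintegral => //; first exact: (intc lo).
  move=> u; rewrite /= in_itv/= => /andP[su ut].
  have sut : s <= u <= t by rewrite (ltW su).
  by have /andP[] := lohi _ sut.
apply: le_Rintegral => //; first exact: (intc hi).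
move=> u; rewrite /= in_itv/= => /andP[su ut].
have sut : s <= u <= t by rewrite (ltW su).
by have /andP[] := lohi _ sut.
Qed.

Lemma continuous_within_sqr f : {within `[0, +oo[, continuous f} ->
  {within `[0, +oo[, continuous (fun t => f t ^+ 2)}.
Proof.
move=> /subspace_continuousP cf; apply/subspace_continuousP => x x0.
by apply: (cvg_comp (fun t => f t) (fun y => y ^+ 2) (cf x x0)); exact: exprn_continuous.
Qed.

(** Serves [rho 0], whose value is prescribed only at nonnegative times. *)
Lemma continuous_within_eq1 f : (forall t, 0 <= t -> f t = 1) ->
  {within `[0, +oo[, continuous f}.
Proof.
move=> f1; apply/subspace_continuousP => x; rewrite /= in_itv/= andbT => x0.
change (f y @[y --> within `[0, +oo[ (nbhs x)] --> f x).
rewrite f1//; apply: cvg_near_cst.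
suff : \forall y \near nbhs x, `[0, +oo[%classic y -> f y = 1 by [].
apply: nearW => y.
by rewrite /= in_itv/= andbT => /f1 ->.
Qed.

End Analysis.

(** * Exceptional events *)

Section BadEvents.
Context {R : realType} {n N M H r K s : nat}.
Variables (q eta : R).
Hypothesis q01 : 0 <= q <= 1.
Implicit Types (z : {ffun 'I_N * vpair n -> bool}) (x y : 'I_N * vpair n).

(** The martingale part of the number of edges of layer [K.+1] arrived before step [l * H]. *)
Definition edge_fluctuation l z : R :=
  \sum_x ((z x)%:R - q) *
     ((x.1 < l * H)%N && `[< dconn K z x.1 (sval x.2).1 (sval x.2).2 >])%:R.

(** The centred number of arrivals in a window at the crossing pairs; these are frozen at the start
    of the window, hence predictable. *)
Definition cross_fluctuation j l z : R :=
  \sum_x ((z x)%:R - q) *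
     ((l * H <= x.1 < l.+1 * H)%N && dcross j.+1 s z (l * H) x.2)%:R.

(* [bits_far] and [bits_off_grid] are the events on which rounding preserves the
   order of the arrivals and their position relative to the macroscopic grid. *)
Definition bits_far z : bool := [forall x, forall y,
  [&& z x, z y, x != y & (x.1 <= y.1)%N] ==> (x.1 + M < y.1)%N].

Definition bits_off_grid z : bool := [forall l : 'I_r.+1, forall x,
  (z x && (l * H <= x.1)%N) ==> (l * H + M <= x.1)%N].

Definition bits_good z : bool :=
  [&& (\sum_x z x <= M)%N, bits_far z, bits_off_grid z,
      [forall l : 'I_r.+1, `|edge_fluctuation l z| <= eta * n%:R] &
      [forall j : 'I_K, forall l : 'I_r, `|cross_fluctuation j l z| <= eta * n%:R]].

Lemma card_window a b : (#|[pred i : 'I_N | (a <= i < b)%N]| <= b - a)%N.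
Proof.
rewrite cardE -(size_map val) -(size_iota a (b - a)).
apply: uniq_leq_size => [|i /mapP[j + ->]].
  by rewrite map_inj_uniq ?enum_uniq//; exact: val_inj.
rewrite mem_enum inE mem_iota => /andP[aj jb]; rewrite aj /=.
by rewrite subnKC// (leq_trans aj (ltnW jb)).
Qed.

Lemma card_window_pairs a b :
  (#|[pred x : 'I_N * vpair n | (a <= x.1 < b)%N]| <= (b - a) * #|{: vpair n}|)%N.
Proof.
rewrite (eq_card (B := [predX [pred i : 'I_N | (a <= i < b)%N] & predT])) => [|x].
  by rewrite cardX leq_mul2r card_window orbT.
by rewrite !inE andbT.
Qed.

(** Union bound over couples of distinct slots at most [M] steps apart: there are at most [M.+1]
    steps for the second slot, and both bits are set with probability [q ^+ 2]. *)
Lemma bprob_not_far : bprob q (fun z => ~~ bits_far z) <=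
  #|{: 'I_N * vpair n}|%:R * (M.+1 * #|{: vpair n}|)%:R * q ^+ 2.
Proof.
pose D (u : ('I_N * vpair n) * ('I_N * vpair n)) :=
  (u.1 != u.2) && (u.1.1 <= u.2.1 < u.1.1 + M.+1)%N.
apply: (@le_trans _ _ (bprob q (fun z => [exists u, D u && (z u.1 && z u.2)]))).
  apply: le_bprob => // z; rewrite negb_forall => /existsP[x].
  rewrite negb_forall => /existsP[y]; rewrite negb_imply -leqNgt.
  move=> /andP[/and4P[zx zy xy le] far].
  by apply/existsP; exists (x, y); rewrite /D /= xy zx zy le /= addnS ltnS far.
apply: (le_trans (bprob_exists q01 _ _)).
rewrite (eq_bigr (fun=> q ^+ 2)) => [|[x y] /andP[/= xy _]]; last first.
  rewrite -(bexp_coord2 q xy); apply: eq_bexp => z.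
  by rewrite -natrM mulnb.
rewrite sumr_const -[leLHS]mulr_natl -natrM ler_wpM2r ?exprn_ge0//; first by case/andP: q01.
rewrite ler_nat -sum1_card big_mkcond -(pair_big xpredT xpredT
  (fun x y => if (x, y) \in D then 1%N else 0%N)) /= -sum_nat_const.
apply: leq_sum => x _; rewrite -big_mkcond sum1_card.
apply: leq_trans (_ : _ <= (x.1 + M.+1 - x.1) * #|{: vpair n}|)%N _; last first.
  by rewrite addKn.
apply: leq_trans (card_window_pairs _ _); apply: subset_leq_card.
by apply/fintype.subsetP => y; rewrite !inE => /andP[].
Qed.

Lemma bprob_on_grid : bprob q (fun z => ~~ bits_off_grid z) <=
  r.+1%:R * (M * #|{: vpair n}|)%:R * q.
Proof.
pose D (u : 'I_r.+1 * ('I_N * vpair n)) := (u.1 * H <= u.2.1 < u.1 * H + M)%N.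
apply: (@le_trans _ _ (bprob q (fun z => [exists u, D u && z u.2]))).
  apply: le_bprob => // z; rewrite negb_forall => /existsP[l].
  rewrite negb_forall => /existsP[x]; rewrite negb_imply -ltnNge.
  by move=> /andP[/andP[zx le] lt]; apply/existsP; exists (l, x); rewrite /D /= le lt.
apply: (le_trans (bprob_exists q01 _ _)).
rewrite (eq_bigr (fun=> q)) => [|u _]; last exact: bexp_coord.
rewrite sumr_const -[leLHS]mulr_natl -natrM ler_wpM2r//; first by case/andP: q01.
rewrite ler_nat -sum1_card big_mkcond -(pair_big xpredT xpredT
  (fun l x => if (l, x) \in D then 1%N else 0%N)) /= -[X in (_ <= X * _)%N](card_ord r.+1).
rewrite -sum_nat_const; apply: leq_sum => l _; rewrite -big_mkcond sum1_card.
apply: leq_trans (_ : _ <= (l * H + M - l * H) * #|{: vpair n}|)%N _; last first.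
  by rewrite addKn.
apply: leq_trans (card_window_pairs _ _); apply: subset_leq_card.
by apply/fintype.subsetP => y; rewrite !inE.
Qed.

Lemma bflip_eq x z (i : nat) : (i <= x.1)%N -> forall y, (y.1 < i)%N -> bflip x z y = z y.
Proof.
move=> ix y yi; rewrite ffunE; case: eqP => // yx.
by move: yi; rewrite yx ltnNge ix.
Qed.

Lemma bprob_edge_fluctuation l (a : R) : 0 < a ->
  bprob q (fun z => a < `|edge_fluctuation l z|) <=
  #|{: 'I_N * vpair n}|%:R * q / a ^+ 2.
Proof.
move=> a0; apply: (bprob_martingale q01 (rank := fun x => nat_of_ord x.1)
  (c := fun x z => (x.1 < l * H)%N && `[< dconn K z x.1 (sval x.2).1 (sval x.2).2 >]) a0).
move=> x y z yx; congr (_ && _); have fl := @bflip_eq x z _ yx.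
by apply/asboolP/asboolP; apply: dconn_local => u /fl.
Qed.

Lemma bprob_cross_fluctuation j l (a : R) : 0 < a ->
  bprob q (fun z => a < `|cross_fluctuation j l z|) <=
  #|{: 'I_N * vpair n}|%:R * q / a ^+ 2.
Proof.
move=> a0; apply: (bprob_martingale q01 (rank := fun x => nat_of_ord x.1)
  (c := fun x z => (l * H <= x.1 < l.+1 * H)%N && dcross j.+1 s z (l * H) x.2) a0).
move=> x y z yx; case: (boolP (l * H <= y.1 < l.+1 * H)%N) => //= /andP[ly _].
by rewrite (eq_dcross _ _ (@bflip_eq x z _ (leq_trans ly yx))).
Qed.

Lemma bprob_not_good c : (0 < M)%N -> 0 < eta * n%:R ->
  c = #|{: 'I_N * vpair n}|%:R * q ->
  bprob q (fun z => ~~ bits_good z) <=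
  c / M%:R + c * ((M.+1 * #|{: vpair n}|)%:R * q) +
  r.+1%:R * (M * #|{: vpair n}|)%:R * q +
  (r.+1 + K * r)%:R * (c / (eta * n%:R) ^+ 2).
Proof.
move=> M0 en0 cE.
pose E1 z := ~~ (\sum_x z x <= M)%N.
pose E4 z := [exists l : 'I_r.+1, true && (eta * n%:R < `|edge_fluctuation l z|)].
pose E5 z := [exists u : 'I_K * 'I_r, true && (eta * n%:R < `|cross_fluctuation u.1 u.2 z|)].
apply: (@le_trans _ _ (bprob q (fun z =>
   E1 z || (~~ bits_far z || (~~ bits_off_grid z || (E4 z || E5 z)))))).
  apply: le_bprob => // z; rewrite !negb_and -/(E1 z).
  case: (E1 z) => //; case: (bits_far z) => //; case: (bits_off_grid z) => //=.
  case/orP; rewrite negb_forall => /existsP.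
    by move=> [l]; rewrite -ltNge => lt; apply/orP; left; apply/existsP; exists l.
  move=> [j]; rewrite negb_forall => /existsP[l]; rewrite -ltNge => lt.
  by apply/orP; right; apply/existsP; exists (j, l).
have p1 : bprob q E1 <= c / M%:R.
  rewrite cE; apply: (le_trans _ (bprob_count_gt q01 (_ : 0 < M%:R))); last by rewrite ltr0n.
  apply: le_bprob => // z; rewrite /E1 -ltnNge -(ltr_nat R).
  by rewrite natr_sum.
have p4 : bprob q E4 <= r.+1%:R * (c / (eta * n%:R) ^+ 2).
  apply: (le_trans (bprob_exists q01 _ _)).
  rewrite [leRHS](_ : _ = \sum_(l < r.+1) (c / (eta * n%:R) ^+ 2)); last first.
    by rewrite sumr_const card_ord mulr_natl.
  apply: ler_sum => l _.
  by rewrite cE; exact: bprob_edge_fluctuation.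
have p5 : bprob q E5 <= (K * r)%:R * (c / (eta * n%:R) ^+ 2).
  apply: (le_trans (bprob_exists q01 _ _)).
  rewrite [leRHS](_ : _ = \sum_(u : 'I_K * 'I_r) (c / (eta * n%:R) ^+ 2)); last first.
    by rewrite sumr_const card_prod !card_ord mulr_natl.
  apply: ler_sum => u _.
  by rewrite cE; exact: bprob_cross_fluctuation.
have p2 : bprob q (fun z => ~~ bits_far z) <= c * ((M.+1 * #|{: vpair n}|)%:R * q).
  by apply: (le_trans bprob_not_far); rewrite cE le_eqVlt expr2; apply/orP; left; apply/eqP; ring.
have p3 := bprob_on_grid.
rewrite natrD mulrDl.
apply: (le_trans (bprobU q01 _ _)); rewrite -!addrA lerD//.
apply: (le_trans (bprobU q01 _ _)); rewrite lerD//.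
apply: (le_trans (bprobU q01 _ _)); rewrite lerD//.
by apply: (le_trans (bprobU q01 _ _)); rewrite lerD.
Qed.

(** The mean number of arrivals is of order [n], so Markov with [M = n ^ 2] and Chebyshev at scale
    [eta * n] both give order [1 / n]. A window of [M] steps contains an arrival with probability of
    order at most [n ^ -3], which keeps the two rounding failures below that order. *)
Lemma bprob_not_good_le (del : R) : (0 < n)%N -> 0 < del -> 0 < eta ->
  M = (n ^ 2)%N -> H = (n ^ 6)%N -> N = (r * H + M)%N ->
  q <= del / (H%:R * n%:R) ->
  bprob q (fun z => ~~ bits_good z) <=
  (r.+1%:R * del * (2 + 2 * del + (r.+1 + K * r)%:R / eta ^+ 2)) / n%:R.
Proof.
move=> n0 del0 eta0 ME HE NE qle.
have [q0 q1] := andP q01.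
have nR : 1 <= n%:R :> R by rewrite ler1n.
have nR0 : 0 < n%:R :> R by rewrite ltr0n.
have HR0 : 0 < H%:R :> R by rewrite HE ltr0n expn_gt0 n0.
have Vn : (#|{: vpair n}| <= n ^ 2)%N.
  by have := @card_vpair n; rewrite -mulnn; lia.
have VR : (#|{: vpair n}|)%:R <= n%:R ^+ 2 :> R by rewrite -natrX ler_nat.
have MH : (M <= H)%N by rewrite ME HE leq_pexp2l.
have Vq : (#|{: vpair n}|)%:R * q <= del * n%:R / H%:R.
  apply: (@le_trans _ _ (n%:R ^+ 2 * (del / (H%:R * n%:R)))).
    by apply: ler_pM.
  by rewrite le_eqVlt; apply/orP; left; apply/eqP; field; rewrite !gt_eqF.
have cE : (#|{: 'I_N * vpair n}|)%:R * q <= r.+1%:R * del * n%:R.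
  rewrite card_prod card_ord natrM -mulrA.
  apply: (@le_trans _ _ ((r.+1 * H)%:R * (del * n%:R / H%:R))).
    apply: ler_pM => //; first by rewrite mulr_ge0.
    by rewrite ler_nat NE mulSn addnC leq_add2r.
  by rewrite natrM le_eqVlt; apply/orP; left; apply/eqP; field; rewrite gt_eqF.
have c0 : 0 <= (#|{: 'I_N * vpair n}|)%:R * q by rewrite mulr_ge0.
apply: (le_trans (bprob_not_good _ _ erefl)); rewrite ?mulr_gt0//.
  by rewrite ME expn_gt0 n0.
move: cE c0; set c := _ * q => cE c0; set C := r.+1%:R * del in cE *.
have C0 : 0 <= C by rewrite mulr_ge0// ltW.
have HnR : H%:R = n%:R ^+ 6 :> R by rewrite HE natrX.
have MnR : M%:R = n%:R ^+ 2 :> R by rewrite ME natrX.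
have nV : n%:R^-1 <= 1 :> R by rewrite invf_le1.
have nV0 : 0 <= n%:R^-1 :> R by rewrite invr_ge0 ltW.
have t1 : c / M%:R <= C / n%:R.
  rewrite MnR ler_pdivrMr ?exprn_gt0// (le_trans cE)// le_eqVlt.
  by apply/orP; left; apply/eqP; field; rewrite gt_eqF.
have VqM k : (k%:R <= 2 * n%:R ^+ 2 :> R) ->
    (k * #|{: vpair n}|)%:R * q <= 2 * del / n%:R ^+ 2.
  move=> kn; rewrite natrM -mulrA.
  apply: (@le_trans _ _ (2 * n%:R ^+ 2 * (del * n%:R / H%:R))).
    by apply: ler_pM => //; rewrite mulr_ge0.
  have -> : 2 * n%:R ^+ 2 * (del * n%:R / H%:R) = 2 * del / n%:R ^+ 2 * n%:R^-1.
    by rewrite HnR; field; rewrite gt_eqF.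
  rewrite ler_piMr// divr_ge0 ?exprn_ge0 ?mulr_ge0// ?ltW//.
have t2 : c * ((M.+1 * #|{: vpair n}|)%:R * q) <= C * (2 * del) / n%:R.
  apply: (@le_trans _ _ (C * n%:R * (2 * del / n%:R ^+ 2))).
    apply: ler_pM => //; first by rewrite mulr_ge0.
    apply: VqM; rewrite -natr1 MnR; have : 1 <= n%:R ^+ 2 :> R by rewrite exprn_ege1.
    by lra.
  by rewrite le_eqVlt; apply/orP; left; apply/eqP; field; rewrite gt_eqF.
have t3 : r.+1%:R * (M * #|{: vpair n}|)%:R * q <= C / n%:R.
  rewrite (_ : _ * q = r.+1%:R * (M%:R * ((#|{: vpair n}|)%:R * q))); last by rewrite natrM; ring.
  apply: (@le_trans _ _ (r.+1%:R * (n%:R ^+ 2 * (del * n%:R / H%:R)))).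
    by rewrite ler_wpM2l// MnR ler_wpM2l// exprn_ge0// ltW.
  have -> : r.+1%:R * (n%:R ^+ 2 * (del * n%:R / H%:R)) = C / n%:R * n%:R^-1 ^+ 2.
    by rewrite /C HnR; field; rewrite gt_eqF.
  by rewrite ler_piMr ?divr_ge0 ?exprn_ile1// ltW.
have t4 : (r.+1 + K * r)%:R * (c / (eta * n%:R) ^+ 2) <=
    C * ((r.+1 + K * r)%:R / eta ^+ 2) / n%:R.
  apply: (@le_trans _ _ ((r.+1 + K * r)%:R * (C * n%:R / (eta * n%:R) ^+ 2))).
    by rewrite ler_wpM2l// ler_wpM2r// invr_ge0 exprn_ge0// mulr_ge0// ltW.
  by rewrite le_eqVlt; apply/orP; left; apply/eqP; field; rewrite !gt_eqF.
apply: (le_trans (lerD (lerD (lerD t1 t2) t3) t4)).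
by rewrite le_eqVlt; apply/orP; left; apply/eqP; field; rewrite !gt_eqF.
Qed.

End BadEvents.

(** * Edge counts at grid times *)

Section Squeeze.
Context {R : realType} {n N M H r K s : nat}.
Variables (z : {ffun 'I_N * vpair n -> bool}).
Variables (q del kappa eta : R) (rho : nat -> R -> R) (I : R -> R).
Hypothesis n0 : (0 < n)%N.
Hypothesis NE : N = (r * H + M)%N.
Hypothesis del0 : 0 < del.
Hypothesis q0 : 0 <= q.
Hypothesis eta0 : 0 <= eta.
Hypothesis eta_kappa : eta <= kappa / 4.
Hypothesis s_lo : kappa * n%:R < s%:R.
Hypothesis s_hi : s%:R <= kappa * n%:R + 1.
Hypothesis eta_sprinkling : eta * n%:R < q * H%:R * (s * s)%:R.
Hypothesis rho0 : forall t, 0 <= t -> rho 0 t = 1.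
Hypothesis rho01 : forall j t, 0 <= t -> 0 <= rho j t <= 1.
Hypothesis rho_unif : forall j t u, (j <= K)%N -> 0 <= t <= r%:R * del ->
  0 <= u <= r%:R * del -> `|t - u| <= del -> `|rho j t - rho j u| < kappa / 4.
Hypothesis C1_rho : forall j l, (0 < j <= K)%N -> (l <= r)%N ->
  `|(dC1 j z (l * H))%:R / n%:R - rho j (l%:R * del)| <= eta.
Hypothesis edges_martingale : forall l, (l <= r)%N ->
  `|\sum_x ((z x)%:R - q) *
     ((x.1 < l * H)%N && `[< dconn K z x.1 (sval x.2).1 (sval x.2).2 >])%:R| <= eta * n%:R.
Hypothesis cross_martingale : forall j l, (j < K)%N -> (l < r)%N ->
  `|\sum_x ((z x)%:R - q) *
     ((l * H <= x.1 < l.+1 * H)%N && dcross j.+1 s z (l * H) x.2)%:R| <= eta * n%:R.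

Let n0R : 0 < n%:R :> R. Proof. by rewrite ltr0n. Qed.

Let grid_in l : (l <= r)%N -> 0 <= l%:R * del <= r%:R * del.
Proof. by move=> lr; rewrite mulr_ge0 ?(ltW del0)//= ler_wpM2r ?ler_nat ?(ltW del0). Qed.

Let kappa0 : 0 <= kappa.
Proof. by rewrite -(@pmulr_lge0 _ 4^-1) ?invr_gt0// (le_trans eta0). Qed.

Lemma sum_window (F : nat -> R) a b : (a <= b <= N)%N ->
  \sum_(i < N) (a <= i < b)%N%:R * F i = \sum_(a <= i < b) F i.
Proof.
move=> /andP[ab bN].
rewrite -(big_mkord xpredT (fun i => (a <= i < b)%N%:R * F i)).
rewrite (@big_cat_nat _ _ _ a)//=; last exact: leq_trans bN.
rewrite (@big_cat_nat _ _ _ b a N)//=.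
rewrite big_nat big1 ?add0r => [|i /andP[_ ia]]; last first.
  by rewrite leqNgt ia mul0r.
rewrite [X in _ + X]big_nat [X in _ + X]big1 ?addr0 => [|i /andP[bi _]]; last first.
  by rewrite [(i < b)%N]ltnNge bi andbF mul0r.
rewrite big_nat [RHS]big_nat; apply: eq_bigr => i ->.
by rewrite mul1r.
Qed.

Lemma sum_window_pairs (F : nat -> vpair n -> bool) a b : (a <= b <= N)%N ->
  \sum_(x : 'I_N * vpair n) ((a <= x.1 < b)%N && F x.1 x.2)%:R =
  \sum_(a <= i < b) (\sum_p F i p)%N%:R :> R.
Proof.
move=> ab; rewrite -(sum_window (fun i => (\sum_p F i p)%N%:R) ab).
rewrite -(pair_big xpredT xpredT (fun (i : 'I_N) (p : vpair n) => ((a <= i < b)%N && F i p)%:R : R)) /=.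
apply: eq_bigr => i _; rewrite natr_sum mulr_sumr.
by apply: eq_bigr => p _; rewrite -natrM mulnb.
Qed.

(** Sprinkling over the window from [l * H] to [l.+1 * H], by induction on the layer; layer 0 has a
    single component. *)
Lemma duniq_grid j l : (j <= K)%N -> (l < r)%N -> duniq j s z (l * H).
Proof.
elim: j => [//|j IH] jK lr.
have ll1 : (l * H <= l.+1 * H)%N by rewrite leq_mul2r leqnSn orbT.
have l1N : (l.+1 * H <= N)%N.
  by rewrite NE (leq_trans _ (leq_addr _ _))// leq_mul2r lr orbT.
apply: (@duniq_sprinkling _ _ j s z (l * H) (l.+1 * H)) => //.
- exact: IH (ltnW jK) lr.
(* The relative growth of the largest component is at most [2 * eta + kappa / 4], less than [kappa]
   and thus less than [s / n]. *)
- have := C1_rho (j := j.+1) jK (ltnW lr); have := C1_rho (j := j.+1) jK lr.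
  have : `|rho j.+1 (l%:R * del) - rho j.+1 (l.+1%:R * del)| < kappa / 4.
    apply: rho_unif => //; [exact: grid_in (ltnW lr)|exact: grid_in|].
    by rewrite -mulrBl -natr1 opprD addrA subrr add0r mulN1r normrN gtr0_norm.
  set u := rho _ _; set v := rho _ _; rewrite !ler_norml ltr_norml => uv ca cb.
  rewrite -(ltr_nat R) natrD -(@ltr_pM2r _ n%:R^-1) ?invr_gt0//.
  rewrite mulrDl; set a := _ / n%:R; set b := _ / n%:R.
  have : kappa < s%:R / n%:R by rewrite ltr_pdivlMr.
  rewrite -/b in cb. move: (s%:R / n%:R) => sn.
  move: uv ca cb; rewrite -/a; have ek := eta_kappa.
  by move=> /andP[? ?] /andP[? ?] /andP[? ?] ?; lra.
(* Without an arrival at a crossing pair, the fluctuation is minus its compensator, which is at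
   least [q * H * s^2] and exceeds the allowed [eta * n]. *)
- move=> ss; apply: contrapT => no.
  have := cross_martingale jK lr.
  rewrite (eq_bigr (fun x : 'I_N * vpair n => (- q) *
     ((l * H <= x.1 < l.+1 * H)%N && dcross j.+1 s z (l * H) x.2)%:R)); last first.
    move=> x _; case: (boolP (_ && dcross _ _ _ _ _)) => [/andP[xl cx]|]; last by rewrite !mulr0.
    case zx: (z x); last by rewrite sub0r.
    by case: no; exists x.
  rewrite -mulr_sumr (sum_window_pairs (fun _ p => dcross j.+1 s z (l * H) p)) ?ll1//.
  rewrite sumr_const_nat -mulnBl subSnn mul1n mulNr normrN ger0_norm; last first.
    by rewrite mulr_ge0// mulrn_wge0.
  apply/negP; rewrite -ltNge (lt_le_trans eta_sprinkling)// -mulrA ler_wpM2l//.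
  by rewrite -[leRHS]mulr_natl ler_wpM2l// ler_nat.
Qed.

(** [2 * eta] comes from replacing the squared relative size by the square of [rho], [kappa] from
    the small components, and the inverse of [n] from the diagonal. *)
Lemma dpairs_grid l : (l < r)%N ->
  `|2 * (dpairs K z (l * H))%:R / n%:R ^+ 2 - rho K (l%:R * del) ^+ 2| <=
  2 * eta + kappa + n%:R^-1.
Proof.
move=> lr.
have /andP[lo hi] := dpairs_bounds n0 (duniq_grid (leqnn K) lr).
have C1n j i : (dC1 j z i <= n)%N.
  apply/bigop.bigmax_leqP => v _; rewrite -[X in (_ <= X)%N](card_ord n).
  exact: max_card.
pose c : R := (dC1 K z (l * H))%:R / n%:R.
have c01 : 0 <= c <= 1 by rewrite divr_ge0//= ler_pdivrMr// mul1r ler_nat.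
have crho : `|c - rho K (l%:R * del)| <= eta.
  (* [C1_rho] starts at layer 1; layer 0 is complete, so its component has size [n] and [rho 0] is
     1. *)
  case: (posnP K) => [K0|K0]; last by apply: C1_rho; rewrite ?K0//= ltnW.
  have t0 : 0 <= l%:R * del by rewrite mulr_ge0// ltW.
  have : dC1 K z (l * H) = n.
    apply/eqP; rewrite eqn_leq C1n K0 /=.
    apply: leq_trans (leq_dC1 0 z (l * H) (Ordinal n0)).
    rewrite -[X in (X <= _)%N](card_ord n); apply: subset_leq_card.
    by apply/fintype.subsetP => v _; rewrite in_dcomp; apply/asboolP.
  by rewrite /c => ->; rewrite divff ?gt_eqF// K0 rho0// subrr normr0.
have := rho01 K (mulr_ge0 (ler0n _ l) (ltW del0)).
move: crho; set u := rho _ _; rewrite ler_norml => /andP[cu1 cu2] /andP[u0 u1].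
move: lo hi; rewrite -!(ler_nat R) !natrD !natrM.
have -> : (dC1 K z (l * H))%:R = c * n%:R by rewrite /c divfK ?gt_eqF.
set Q := (dpairs _ _ _)%:R => lo hi.
have n1 : n%:R^-1 * n%:R = 1 :> R by rewrite mulVf ?gt_eqF.
have n2 : 0 < n%:R ^+ 2 :> R by rewrite exprn_gt0.
have -> : 2 * Q / n%:R ^+ 2 - u ^+ 2 = (2 * Q - u ^+ 2 * n%:R ^+ 2) / n%:R ^+ 2.
  by rewrite mulrBl mulfK ?gt_eqF.
rewrite normrM [X in _ * X]gtr0_norm ?invr_gt0// ler_pdivrMr//.
have /andP[c0 c1] := c01.
have cu : - (2 * eta) <= c ^+ 2 - u ^+ 2 <= 2 * eta by rewrite !expr2; nra.
have -> : (2 * eta + kappa + n%:R^-1) * n%:R ^+ 2 =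
   2 * eta * n%:R ^+ 2 + kappa * n%:R ^+ 2 + n%:R :> R.
  by rewrite expr2 !mulrDl; congr (_ + _); rewrite mulrA n1 mul1r.
have kap0 := kappa0.
have n1R : 1 <= n%:R :> R by rewrite ler1n.
have sn : s%:R * n%:R <= kappa * n%:R ^+ 2 + n%:R.
  by rewrite expr2 mulrA -[X in _ <= _ + X]mul1r -mulrDl ler_wpM2r.
have cun : - (2 * eta) * n%:R ^+ 2 <= (c ^+ 2 - u ^+ 2) * n%:R ^+ 2 <= 2 * eta * n%:R ^+ 2.
  by have /andP[? ?] := cu; rewrite !ler_wpM2r// ltW.
have cn : c * n%:R * (c * n%:R) = c ^+ 2 * n%:R ^+ 2 by ring.
have kn : 0 <= kappa * n%:R ^+ 2 by rewrite mulr_ge0// ltW.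
move: cun; rewrite mulrBl ler_norml => /andP[? ?]; apply/andP; split; lra.
Qed.

(** * Comparison of the compensator with the integral *)

Hypothesis qH : del * (1 - del / n%:R) <= q * H%:R * n%:R <= del.
Hypothesis I0 : I 0 = 0.
Hypothesis I_step : forall l, (l < r)%N ->
  `|I (l.+1%:R * del) - I (l%:R * del) - del / 2 * rho K (l%:R * del) ^+ 2| <=
  del * (kappa / 4).

(** Error per unit of time: [kappa] from counting pairs and from the variation of [rho] over a
    window, [kappa / 4] from the integral, [1 / (2 * n)] from the diagonal and [del / (2 * n)] from
    the exponential in [q]. *)
Let phi := kappa * 5 / 4 + (1 + del) / (2 * n%:R).

(** The number of connected pairs is nondecreasing, so over a window it lies between its values at
    the two ends, which are grid times and controlled by [dpairs_grid]. *)
Lemma window_compensator l : (l.+1 < r)%N ->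
  `|q / n%:R * \sum_(l * H <= i < l.+1 * H) (dpairs K z i)%:R -
    (I (l.+1%:R * del) - I (l%:R * del))| <= del * phi.
Proof.
move=> lr; have lr' := ltnW lr.
have := I_step lr'; set J := I _ - I _.
have := dpairs_grid lr'; have := dpairs_grid lr.
have : `|rho K (l%:R * del) - rho K (l.+1%:R * del)| < kappa / 4.
  apply: rho_unif => //; [exact: grid_in (ltnW lr')|exact: grid_in|].
  by rewrite -mulrBl -natr1 opprD addrA subrr add0r mulN1r normrN gtr0_norm.
have := rho01 K (mulr_ge0 (ler0n _ l.+1) (ltW del0)).
have := rho01 K (mulr_ge0 (ler0n _ l) (ltW del0)).
set u := rho _ _; set v := rho _ _.
set Qa := (dpairs K z (l * H))%:R; set Qb := (dpairs K z (l.+1 * H))%:R.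
move=> /andP[u0 u1] /andP[v0 v1].
rewrite ltr_norml => /andP[uv1 uv2].
have uv : - (kappa / 2) <= v ^+ 2 - u ^+ 2 <= kappa / 2 by rewrite !expr2; nra.
set W := \sum_(_ <= i < _) _.
have ll1 : (l * H <= l.+1 * H)%N by rewrite leq_mul2r leqnSn orbT.
have Wlo : H%:R * Qa <= W.
  rewrite [leLHS](_ : _ = \sum_(l * H <= i < l.+1 * H) Qa); last first.
    by rewrite sumr_const_nat -mulnBl subSnn mul1n mulr_natl.
  rewrite /W big_nat [leRHS]big_nat; apply: ler_sum => i /andP[li _].
  by rewrite ler_nat dpairs_mono.
have Whi : W <= H%:R * Qb.
  rewrite [leRHS](_ : _ = \sum_(l * H <= i < l.+1 * H) Qb); last first.
    by rewrite sumr_const_nat -mulnBl subSnn mul1n mulr_natl.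
  rewrite /W big_nat [leRHS]big_nat; apply: ler_sum => i /andP[_ il].
  by rewrite ler_nat dpairs_mono// ltnW.
have n2 : 0 < n%:R ^+ 2 :> R by rewrite exprn_gt0.
pose A := 2 * Qa / n%:R ^+ 2; pose B := 2 * Qb / n%:R ^+ 2.
pose y := q * H%:R * n%:R.
have eA : q / n%:R * (H%:R * Qa) = y * A / 2.
  by rewrite /y /A; field; rewrite gt_eqF.
have eB : q / n%:R * (H%:R * Qb) = y * B / 2.
  by rewrite /y /B; field; rewrite gt_eqF.
have qn0 : 0 <= q / n%:R by rewrite divr_ge0// ltW.
have wlo : y * A / 2 <= q / n%:R * W by rewrite -eA ler_wpM2l.
have whi : q / n%:R * W <= y * B / 2 by rewrite -eB ler_wpM2l.
rewrite -/A -/B; move: (q / n%:R * W) wlo whi => w wlo whi.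
rewrite !ler_norml => /andP[B1 B2] /andP[A1 A2] /andP[J1 J2].
have y0 : 0 <= y by rewrite !mulr_ge0.
have /andP[y1 y2] : del * (1 - del / n%:R) <= y <= del by [].
have phiE : phi = kappa * 5 / 4 + (n%:R^-1 + del / n%:R) / 2.
  by rewrite /phi; field; rewrite gt_eqF.
set ni := n%:R^-1 in phiE A1 A2 B1 B2; set dn := del / n%:R in phiE y1.
have ni0 : 0 <= ni by rewrite invr_ge0 ltW.
have dn0 : 0 <= dn by rewrite divr_ge0 ?ltW.
have u2 : 0 <= u ^+ 2 <= 1 by rewrite expr2; nra.
have /andP[uv3 uv4] := uv; have /andP[u3 u4] := u2.
(* At most [kappa / 2] for [2 * eta], [kappa] for the small components and [kappa / 2] for the
   change of the squared [rho] across the window. *)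
pose th := kappa * 2 + ni.
have kap0 := kappa0; have ek := eta_kappa.
have th0 : 0 <= th by rewrite /th; lra.
have A3 : u ^+ 2 - th <= A by rewrite /th; lra.
have B3 : B <= u ^+ 2 + th by rewrite /th; lra.
have yA : y * (u ^+ 2 - th) <= y * A by rewrite ler_wpM2l.
have yB : y * B <= y * (u ^+ 2 + th) by rewrite ler_wpM2l.
have yth : y * th <= del * th by rewrite ler_wpM2r.
have yu1 : y * u ^+ 2 <= del * u ^+ 2 by rewrite ler_wpM2r.
have yu2 : del * (1 - dn) * u ^+ 2 <= y * u ^+ 2 by rewrite ler_wpM2r.
have ddu : del * dn * u ^+ 2 <= del * dn.
  by rewrite -[leRHS]mulr1 ler_wpM2l// mulr_ge0// ltW.
have ddn : 0 <= del * dn by rewrite mulr_ge0// ltW.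
have dk : 0 <= del * kappa by rewrite mulr_ge0 ?ltW//; lra.
rewrite phiE; move: yA yB yth yu1 yu2; rewrite /th => *.
apply/andP; split; lra.
Qed.

(** The edge count is the martingale part, at most [eta * n], plus a compensator that is summed
    window by window. *)
Lemma edges_grid l : (l < r)%N ->
  `|(\sum_(x : 'I_N * vpair n) ((x.1 < l * H)%N && z x &&
      `[< dconn K z x.1 (sval x.2).1 (sval x.2).2 >]))%N%:R / n%:R - I (l%:R * del)| <=
  eta + l%:R * (del * phi).
Proof.
move=> lr.
have comp m : (m <= l)%N -> `|q / n%:R * \sum_(0 <= i < m * H) (dpairs K z i)%:R -
    I (m%:R * del)| <= m%:R * (del * phi).
  elim: m => [_|m IH ml].
    by rewrite mul0n big_geq// mulr0 !mul0r I0 subrr normr0.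
  have := IH (ltnW ml); have := window_compensator (leq_ltn_trans ml lr).
  set w := \sum_(m * H <= i < _) _; set w0 := \sum_(0 <= i < _) _ => h1 h2.
  have -> : \sum_(0 <= i < m.+1 * H) (dpairs K z i)%:R = w0 + w :> R.
    by rewrite (@big_cat_nat _ _ _ (m * H)%N)//= leq_mul2r leqnSn orbT.
  have -> : m.+1%:R * (del * phi) = m%:R * (del * phi) + del * phi.
    by rewrite -natr1 mulrDl mul1r.
  rewrite (le_trans _ (lerD h2 h1))// (le_trans _ (ler_normD _ _))//.
  by rewrite le_eqVlt; apply/orP; left; apply/eqP; congr `|_|; ring.
have := comp l (leqnn l); have := edges_martingale (ltnW lr).
set E := (\sum_x _)%N; set w := \sum_(0 <= i < _) _.
have -> : \sum_x ((z x)%:R - q) *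
     ((x.1 < l * H)%N && `[< dconn K z x.1 (sval x.2).1 (sval x.2).2 >])%:R = E%:R - q * w.
  have lN : (0 <= l * H <= N)%N.
    by rewrite /= NE (leq_trans _ (leq_addr _ _))// leq_mul2r ltnW ?orbT.
  rewrite /w -(sum_window_pairs
    (fun i p => `[< dconn K z i (sval p).1 (sval p).2 >]) lN) /=.
  rewrite /E natr_sum mulr_sumr -sumrB; apply: eq_bigr => x _.
  rewrite mulrBl -natrM mulnb; congr (_ %:R - _).
  by rewrite andbCA andbA.
move=> h1 h2.
have -> : E%:R / n%:R - I (l%:R * del) =
    (E%:R - q * w) / n%:R + (q / n%:R * w - I (l%:R * del)).
  by rewrite mulrBl; ring.
apply: le_trans (ler_normD _ _) _; apply: lerD => //.
by rewrite normrM [X in _ * X]gtr0_norm ?invr_gt0// ler_pdivrMr.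
Qed.

End Squeeze.

(** * Convergence to zero in outer probability *)

Section OuterProbability.
Context {R : realType} {d : nat -> measure_display}
  {Om : forall n, measurableType (d n)} (P : forall n, probability (Om n) R).
Implicit Types A B : forall n, set (Om n).

Lemma outer_prob_to0_sub A B : (\forall n \near \oo, A n `<=` B n) ->
  outer_prob_to0 P B -> outer_prob_to0 P A.
Proof.
move=> AB HB delta delta0; have := HB _ delta0.
apply: filter_app; apply: filterS AB => n AB [C [mC BC PC]].
by exists C; split=> //; exact: subset_trans BC.
Qed.

Lemma outer_prob_to0U A B : outer_prob_to0 P A -> outer_prob_to0 P B ->
  outer_prob_to0 P (fun n => A n `|` B n).
Proof.
move=> HA HB delta delta0; have d2 : 0 < delta / 2 by rewrite divr_gt0.
have := HA _ d2; apply: filter_app; have := HB _ d2; apply: filterS.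
move=> n [C [mC BC PC]] [D [mD AD PD]]; exists (D `|` C); split.
- exact: measurableU.
- exact: setUSS.
- apply: (le_trans (measureU2 _ _ _)) => //.
  by rewrite (splitr delta) EFinD; exact: leeD.
Qed.

Lemma outer_prob_to0_exists (K : nat) (A : nat -> forall n, set (Om n)) :
  (forall j, (0 < j <= K)%N -> outer_prob_to0 P (A j)) ->
  outer_prob_to0 P (fun n => [set om | exists2 j, (0 < j <= K)%N & A j n om]).
Proof.
elim: K => [_|K IH AP].
  move=> delta delta0; apply: nearW => n; exists set0; split.
  - exact: measurable0.
  - by move=> om /= [[|j]].
  - by rewrite measure0 lee_fin ltW.
have IH' : outer_prob_to0 P (fun n => [set om | exists2 j, (0 < j <= K)%N & A j n om]).
  by apply: IH => j /andP[j0 jK]; apply: AP; rewrite j0 ltnW.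
apply: outer_prob_to0_sub (outer_prob_to0U IH' (AP K.+1 (leqnn _))).
apply: nearW => n om /= [j /andP[j0]]; rewrite leq_eqVlt => /orP[/eqP -> AK|jK Aj].
  by right.
by left; exists j; rewrite ?j0.
Qed.

Lemma outer_prob_to0_rate A (D : R) :
  (\forall n \near \oo, exists B : set (Om n),
     [/\ measurable B, A n `<=` B & P n B <= (D / n%:R)%:E]%E) ->
  outer_prob_to0 P A.
Proof.
move=> HA delta delta0; apply: filter_app HA.
exists (Num.truncn (D / delta)).+1 => // n /= Dn [B [mB AB PB]].
exists B; split=> //; apply: le_trans PB _; rewrite lee_fin.
have n0 : 0 < n%:R :> R by rewrite ltr0n (leq_trans _ Dn).
rewrite ler_pdivrMr// mulrC -ler_pdivrMr//.
by rewrite (le_trans (ltW (truncnS_gt _)))// ler_nat.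
Qed.

End OuterProbability.

(** * Deterministic estimate on the good event *)

Section EdgeCount.
Context {R : realType}.

(** The lower bound follows from [exp (- x) <= 1 / (1 + x)] and
    [(1 - x + x^2) * (1 + x) = 1 + x^3]. *)
Lemma expRN_bounds (x : R) : 0 <= x -> x * (1 - x) <= 1 - expR (- x) <= x.
Proof.
move=> x0; have := expR_ge1Dx x; have := expR_ge1Dx (- x).
have := expRxMexpNx_1 x; have := expR_gt0 (- x).
set a := expR x; set b := expR (- x) => b0 ab b1 a1.
have bx : b * (1 + x) <= 1.
  by rewrite -[leRHS]ab mulrC ler_wpM2r// ltW.
apply/andP; split; last by lra.
suff : b <= 1 - x + x ^+ 2 by rewrite mulrBr mulr1 -expr2; lra.
rewrite -(@ler_pM2r _ (1 + x)); last by lra.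
apply: (le_trans bx).
have -> : (1 - x + x ^+ 2) * (1 + x) = 1 + x ^+ 3 by ring.
by rewrite lerDl exprn_ge0.
Qed.

Lemma sqr_close (x y w : R) : 0 <= x <= 1 -> 0 <= y <= 1 ->
  `|x - y| < w / 4 -> x ^+ 2 - w / 2 <= y ^+ 2 <= x ^+ 2 + w / 2.
Proof.
move=> /andP[? ?] /andP[? ?]; rewrite ltr_norml !expr2 => /andP[? ?].
by apply/andP; split; nra.
Qed.

Lemma half_close (J c w del : R) :
  (c - w / 2) * del <= J -> J <= (c + w / 2) * del ->
  `|2^-1 * J - del / 2 * c| <= del * (w / 4).
Proof. by rewrite ler_norml => *; apply/andP; split; lra. Qed.

Lemma monotone_interpolation (e1 e e2 i1 i i2 w eps : R) : w <= eps ->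
  `|e1 - i1| <= eps / 2 -> `|e2 - i2| <= eps / 2 -> e1 <= e -> e <= e2 ->
  i - i1 <= w / 2 -> i2 - i <= w / 2 -> `|e - i| <= eps.
Proof.
rewrite !ler_norml => ? /andP[? ?] /andP[? ?] *.
by apply/andP; split; lra.
Qed.

(** Explains the choice of [kappa]: the error is at most [kappa / 4 + (T + 3) * (7 * kappa / 4)],
    which is below [kappa * (4 * T + 13) / 2]. *)
Lemma error_budget (T kappa eps eta y u : R) : 0 <= T -> 0 < kappa ->
  kappa * (4 * T + 13) = eps -> eta <= kappa / 4 -> 0 <= y -> y <= kappa / 2 ->
  0 <= u -> u <= T + 3 -> eta + u * (kappa * 5 / 4 + y) <= eps / 2.
Proof.
move=> T0 kappa0 <- eta1 y0 y1 u0 u1.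
apply: (@le_trans _ _ (eta + (T + 3) * (kappa * 7 / 4))).
  by rewrite lerD2l; apply: ler_pM => //; lra.
have kT : 0 <= kappa * T by rewrite mulr_ge0// ltW.
lra.
Qed.

Lemma uniform_modulus (K : nat) (rho : nat -> R -> R) (T w : R) : 0 < w ->
  (forall j, (j <= K)%N -> {within `[0, +oo[, continuous (rho j)}) ->
  exists2 del, 0 < del & forall j s t, (j <= K)%N -> 0 <= s <= T -> 0 <= t <= T ->
    `|s - t| <= del -> `|rho j s - rho j t| < w.
Proof.
move=> w0; elim: K => [|K IH] rhoC.
  have [del del0 H] := uniform_continuity_segment T w0 (rhoC 0%N (leqnn _)).
  by exists del => // j s t; rewrite leqn0 => /eqP ->; exact: H.
have [del del0 H] := uniform_continuity_segment T w0 (rhoC K.+1 (leqnn _)).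
have [|del' del'0 H'] := IH; first by move=> j jK; exact: rhoC (leqW jK).
exists (Num.min del del'); first by rewrite lt_min del0.
move=> j s t; rewrite leq_eqVlt le_min => jK sT tT /andP[st st'].
by case/orP: jK => [/eqP ->|jK]; [exact: H|exact: H'].
Qed.

Lemma prob_nonpositive_gap {d : measure_display} {T : measurableType d}
    (P : probability T R) (lam : R) (Y : T -> R) :
  measurable_fun setT Y -> exponential_rv P lam Y ->
  P.-negligible [set om | Y om <= 0].
Proof.
move=> mY Yexp; exists (~` (Y @^-1` `]0, +oo[)).
have mA : measurable (Y @^-1` `]0, +oo[).
  by rewrite -[X in measurable X]setTI; apply: mY => //; exact: measurable_itv.
split; first exact: measurableC.
  by rewrite probability_setC// Yexp// mulr0 oppr0 expR0 subee.
by move=> om /= Y0; rewrite in_itv/= andbT => /lt_le_trans/(_ Y0); rewrite ltxx.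
Qed.

(** All randomness is in the last three hypotheses: positive gaps, largest components close to
    [rho], good bits. The mesh [h] makes [H] steps last [del], so step [l * H] is time [l * del]. *)
Lemma edge_count_close (n K r s : nat) (T eps kappa del eta : R)
    (rho : nat -> R -> R) (g : edge n -> R) :
  let H := (n ^ 6)%N in let M := (n ^ 2)%N in let N := (r * H + M)%N in
  let h := del / H%:R in let q := 1 - expR (- (n%:R^-1 * h)) in
  (1 < n)%N -> 0 <= T -> 0 < eps -> kappa = eps / (4 * T + 13) ->
  0 < del -> del <= 1 -> del <= eps -> 0 < eta -> eta <= kappa / 4 ->
  eta <= del * kappa ^+ 2 / 4 -> 2 / kappa <= n%:R ->
  r = (Num.truncn (T / del)).+3 -> s = (Num.truncn (kappa * n%:R)).+1 ->
  (forall t, 0 <= t -> rho 0 t = 1) ->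
  (forall j t, 0 <= t -> 0 <= rho j t <= 1) ->
  {within `[0, +oo[, continuous (rho K)} ->
  (forall j t u, (j <= K)%N -> 0 <= t <= T + 3 -> 0 <= u <= T + 3 ->
    `|t - u| <= del -> `|rho j t - rho j u| < kappa / 4) ->
  (forall e, 0 < g e) ->
  (forall j t, (0 < j <= K)%N -> 0 <= t ->
    `|(C1 (Gkt j (arrival g) t))%:R / n%:R - rho j t| <= eta) ->
  @bits_good R n N M H r K s q eta
    [ffun x : 'I_N * vpair n => `[< hits (fun k => gap_steps h (g (x.2, k))) x.1 >]] ->
  forall t, 0 <= t <= T ->
    finite_set (Gkt K.+1 (arrival g) t) /\
    `|(#|` fset_set (Gkt K.+1 (arrival g) t)|)%:R / n%:R -
      2^-1 * \int[lebesgue_measure]_(u in `[0, t]) (rho K u ^+ 2)| <= eps.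
Proof.
move=> H M N h q n1 T0 eps0 kappaE del0 del1 del_eps eta0 eta1 eta2 nk rE sE
  rho0 rho01 rhoC rhoU g0 C1rho good t /andP[t0 tT].
set z := [ffun x => _] in good.
have n0 : (0 < n)%N by exact: ltnW.
have n0R : 0 < n%:R :> R by rewrite ltr0n.
have n2R : 2 <= n%:R :> R by rewrite ler_nat.
have H0 : (0 < H)%N by rewrite expn_gt0 n0.
have H0R : 1 <= H%:R :> R by rewrite ler1n.
have H0R' : 0 < H%:R :> R by rewrite ltr0n.
have h0 : 0 < h by rewrite divr_gt0.
have kappa0 : 0 < kappa by rewrite kappaE divr_gt0// ltr_wpDl ?mulr_ge0.
have kT : kappa * (4 * T + 13) = eps.
  by rewrite kappaE divfK// gt_eqF// ltr_wpDl ?mulr_ge0.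
have rdel : r%:R * del <= T + 3.
  rewrite rE -[(Num.truncn _).+3]addn3 natrD mulrDl.
  have : (Num.truncn (T / del))%:R * del <= T.
    by rewrite -ler_pdivlMr// truncn_le// divr_ge0// ltW.
  by lra.
have tr l : l%:R * del <= T -> (l.+1 < r)%N.
  rewrite -ler_pdivlMr// => lT; rewrite rE !ltnS -(ler_nat R) (le_trans lT)// ltW//.
  exact: truncnS_gt.
pose x := n%:R^-1 * h.
have xE : x = del / (H%:R * n%:R) by rewrite /x /h; field; rewrite !gt_eqF.
have x0 : 0 < x by rewrite mulr_gt0 ?invr_gt0.
have /andP[qx1 qx2] : x * (1 - x) <= q <= x by exact: expRN_bounds (ltW x0).
have xHn : x * H%:R * n%:R = del by rewrite xE; field; rewrite !gt_eqF.
have xn : x <= del / n%:R.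
  by rewrite xE ler_pM2l// lef_pV2 ?posrE ?mulr_gt0// ler_peMl// ltW.
have dn : del / n%:R <= 2^-1.
  by rewrite ler_pdivrMr// (le_trans del1)//; lra.
have qH : del * (1 - del / n%:R) <= q * H%:R * n%:R <= del.
  apply/andP; split; last by rewrite -[leRHS]xHn !ler_wpM2r// ltW.
  apply: (@le_trans _ _ (x * (1 - x) * H%:R * n%:R)); last by rewrite !ler_wpM2r// ltW.
  have -> : x * (1 - x) * H%:R * n%:R = del * (1 - x) by rewrite -xHn; ring.
  by rewrite ler_wpM2l ?lerB// ltW.
have q0 : 0 <= q by apply: le_trans qx1; rewrite mulr_ge0 ?ltW// subr_gt0
  (le_lt_trans xn)// (le_lt_trans dn)// invf_lt1// ltr1n.
have kn0 : 0 <= kappa * n%:R by rewrite mulr_ge0// ltW.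
have s_lo : kappa * n%:R < s%:R by rewrite sE truncnS_gt.
have s_hi : s%:R <= kappa * n%:R + 1.
  by rewrite sE -natr1 lerD2r truncn_le.
(* With [s >= kappa * n] and [q * H * n >= del / 2], the compensator is at least
   [del * kappa^2 * n / 2], twice the bound on [eta * n]. *)
have spr : eta * n%:R < q * H%:R * (s * s)%:R.
  apply: (@lt_le_trans _ _ (q * H%:R * n%:R * (kappa ^+ 2 * n%:R))); last first.
    rewrite natrM -!mulrA ler_wpM2l// ler_wpM2l//.
    have -> : n%:R * (kappa * (kappa * n%:R)) = (kappa * n%:R) * (kappa * n%:R) by ring.
    by apply: ler_pM => //; exact: ltW.
  rewrite mulrA ltr_pM2r//; apply: (le_lt_trans eta2).
  apply: (@lt_le_trans _ _ (del * 2^-1 * kappa ^+ 2)).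
    have dk : 0 < del * kappa ^+ 2 by rewrite mulr_gt0// exprn_gt0.
    lra.
  rewrite ler_wpM2r// ?exprn_ge0 ?(ltW kappa0)//.
  by case/andP: qH => qH1 _; apply: le_trans qH1; rewrite ler_wpM2l ?(ltW del0)//; lra.
pose I (u : R) : R := 2^-1 * \int[lebesgue_measure]_(v in `[0, u]) (rho K v ^+ 2).
have rhoC2 := continuous_within_sqr rhoC.
have sq01 u : 0 <= u -> 0 <= rho K u ^+ 2 <= 1.
  by move=> u0; have /andP[? ?] := rho01 K u u0; rewrite exprn_ge0// exprn_ile1.
have Imono u v : 0 <= u -> u <= v -> 0 <= I v - I u <= (v - u) / 2.
  move=> u0 uv.
  have /andP[] := @integral_increment R (fun w => rho K w ^+ 2) u v 0 1 rhoC2 u0 uv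
     (fun w uwv => sq01 w (le_trans u0 (proj1 (andP uwv)))).
  rewrite mul0r mul1r /I -mulrBr; set J := (_ - _ : R) => a b.
  by rewrite mulr_ge0 ?invr_ge0//= [leRHS]mulrC ler_wpM2l ?invr_ge0.
have I0 : I 0 = 0 by rewrite /I set_itv1 Rintegral_set1 mulr0.
have I_step l : (l < r)%N ->
  `|I (l.+1%:R * del) - I (l%:R * del) - del / 2 * rho K (l%:R * del) ^+ 2| <=
  del * (kappa / 4).
  move=> lr; set a := l%:R * del; have a0 : 0 <= a by rewrite mulr_ge0// ltW.
  have bE : l.+1%:R * del = a + del by rewrite -natr1 mulrDl mul1r.
  have bT : a + del <= T + 3.
    by apply: le_trans rdel; rewrite -bE ler_pM2r// ler_nat.
  have ab : a <= a + del by rewrite lerDl ltW.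
  have rhow w : a <= w <= a + del ->
      rho K a ^+ 2 - kappa / 2 <= rho K w ^+ 2 <= rho K a ^+ 2 + kappa / 2.
    move=> /andP[aw wb]; have w0 := le_trans a0 aw.
    apply: sqr_close; [exact: rho01|exact: rho01|].
    apply: rhoU => //; rewrite ?a0 ?w0 ?(le_trans ab)// ?(le_trans wb)//.
    by rewrite distrC ger0_norm ?subr_ge0// lerBlDl.
  have /andP[] := integral_increment rhoC2 a0 ab rhow.
  rewrite bE /I -mulrBr [a + del - a]addrAC subrr add0r => J1 J2.
  exact: half_close.
case/and5P: good => zM /forallP zfar /forallP zgrid /forallP zedge /forallP zcross.
have NE : N = (r * H + M)%N by [].
have zfar' (y y' : 'I_N * vpair n) : z y -> z y' -> y != y' ->
    (y.1 <= y'.1)%N -> (y.1 + M < y'.1)%N.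
  move=> zy zy' yy' le; have /forallP/(_ y')/implyP := zfar y; apply.
  by rewrite zy zy' yy' le.
have zgrid' (y : 'I_N * vpair n) l : z y -> (l <= r)%N ->
    (l * H <= y.1)%N -> (l * H + M <= y.1)%N.
  rewrite -ltnS => zy lr le; have /forallP/(_ y)/implyP := zgrid (Ordinal lr).
  by apply; rewrite zy.
have gridE l : (l * H)%:R * h = l%:R * del.
  by rewrite natrM /h; field; rewrite gt_eqF.
have edges l (lr : (l < r)%N) :
    finite_set (Gkt K.+1 (arrival g) (l%:R * del)) /\
    `|(#|` fset_set (Gkt K.+1 (arrival g) (l%:R * del))|)%:R / n%:R - I (l%:R * del)| <=
    eps / 2.
  have [fin cE] := card_grid h0 g0 NE zM zfar' zgrid' K.+1 (ltnW lr).
  rewrite gridE in fin cE; split; first exact: fin.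
  rewrite cE /=.
  have := @edges_grid R n N M H r K s z q del kappa eta rho I n0 NE del0 q0
    (ltW eta0) eta1 s_lo s_hi spr rho0 rho01 _ _ _ _ qH I0 I_step l lr.
  move=> edges_le; apply: (le_trans (edges_le _ _ _ _)).
  - move=> j u v jK /andP[u0 uT] /andP[v0 vT]; apply: rhoU => //.
      by rewrite u0 (le_trans uT).
    by rewrite v0 (le_trans vT).
  - move=> j i jK ir; have /andP[j0 _] := jK.
    rewrite -(C1_grid h0 g0 NE zM zfar' zgrid' j0 ir) gridE.
    by apply: C1rho => //; rewrite mulr_ge0// ltW.
  - by move=> i ir; have := zedge (Ordinal (ir : (i < r.+1)%N)).
  - by move=> j i jK ir; have /forallP/(_ (Ordinal ir)) := zcross (Ordinal jK).
  have lT : l%:R * del <= T + 3.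
    by apply: le_trans rdel; rewrite ler_pM2r// ler_nat ltnW.
  have i2n : (1 + del) / (2 * n%:R) <= kappa / 2.
    rewrite ler_pdivrMr ?mulr_gt0//.
    have -> : kappa / 2 * (2 * n%:R) = kappa * n%:R by field.
    apply: (@le_trans _ _ 2); first by rewrite -[leRHS]/(1 + 1) lerD2l.
    by rewrite mulrC -ler_pdivrMr.
  have y0 : 0 <= (1 + del) / (2 * n%:R).
    by rewrite divr_ge0 ?addr_ge0 ?mulr_ge0// ltW.
  have ld0 : 0 <= l%:R * del by rewrite mulr_ge0// ltW.
  by rewrite mulrA; exact: (error_budget T0 kappa0 kT eta1 y0 i2n ld0 lT).
(* Between grid times the edge count is monotone and the half integral grows by at most
   [del / 2 <= eps / 2], so the estimates at the two neighbours of [t] suffice. *)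
pose l := Num.truncn (t / del).
have lt : l%:R * del <= t by rewrite -ler_pdivlMr// truncn_le// divr_ge0// ltW.
have tl : t <= l.+1%:R * del.
  by rewrite -ler_pdivrMr// ltW// truncnS_gt.
have lr := tr l (le_trans lt tT).
have [fin1 e1] := edges l (ltnW lr); have [fin2 e2] := edges l.+1 lr.
have sub u v : u <= v -> Gkt K.+1 (arrival g) u `<=` Gkt K.+1 (arrival g) v.
  by move=> uv e /= [ge le]; split=> //; exact: le_trans uv.
have fin := sub_finite_set (sub _ _ tl) fin2; split=> //.
have cle u v : u <= v -> finite_set (Gkt K.+1 (arrival g) v) ->
    (#|` fset_set (Gkt K.+1 (arrival g) u)|)%:R / n%:R <=
    (#|` fset_set (Gkt K.+1 (arrival g) v)|)%:R / n%:R :> R.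
  move=> uv finv; rewrite ler_pM2r ?invr_gt0// ler_nat; apply: fsubset_leq_card.
  by rewrite -fset_set_sub//; [exact: sub|exact: sub_finite_set (sub _ _ uv) finv].
have l0 : 0 <= l%:R * del by rewrite mulr_ge0// ltW.
have bE : l.+1%:R * del = l%:R * del + del by rewrite -natr1 mulrDl mul1r.
have /andP[_ m1] := Imono _ _ l0 lt; have /andP[_ m2] := Imono _ _ t0 tl.
apply: (monotone_interpolation del_eps e1 e2 (cle _ _ lt fin) (cle _ _ tl fin2)).
- by rewrite (le_trans m1)// ler_wpM2r ?invr_ge0// lerBlDl -bE.
- by rewrite (le_trans m2)// ler_wpM2r ?invr_ge0// bE lerBlDr [leRHS]addrC lerD2r.
Qed.

End EdgeCount.

(** * Choice of parameters and exceptional sets *)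

Theorem theorem2p2 (R : realType) (d : nat -> measure_display)
  (Om : forall n, measurableType (d n)) (P : forall n, probability (Om n) R)
  (X : forall n, edge n -> Om n -> R)
  (hind : forall n, mutually_independent (P n) (X n))
  (hexp : forall n e, exponential_rv (P n) (n%:R^-1) (X n e))
  (rho : nat -> R -> R)
  (hrho0 : forall t, 0 <= t -> rho 0 t = 1)
  (hrho : forall k, (1 <= k)%N ->
     [/\ {within `[0, +oo[, continuous (rho k)},
         (forall t, 0 <= t -> 0 <= rho k t <= 1) &
         forall eps : R, 0 < eps ->
           outer_prob_to0 P (fun n => [set om | exists t : R, 0 <= t /\
             `| (C1 (Gkt k (arrival (fun e => X n e om)) t))%:R / n%:R
                - rho k t | > eps])]) :
  forall k : nat, (1 <= k)%N -> forall (T eps : R), 0 <= T -> 0 < eps ->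
    outer_prob_to0 P (fun n => [set om | exists t : R, 0 <= t <= T /\
      ~ (finite_set (Gkt k (arrival (fun e => X n e om)) t) /\
         `| (#|` fset_set (Gkt k (arrival (fun e => X n e om)) t)|)%:R / n%:R
            - 2^-1 * \int[lebesgue_measure]_(s in `[0, t]) (rho k.-1 s ^+ 2) |
         <= eps)]).
Proof.
case=> // K _ T eps T0 eps0.
pose kappa := eps / (4 * T + 13).
have kappa0 : 0 < kappa by rewrite divr_gt0//; lra.
have rhoC j : {within `[0, +oo[, continuous (rho j)}.
  by case: j => [|j]; [exact: continuous_within_eq1|have [] := hrho j.+1 isT].
have rho01 j t : 0 <= t -> 0 <= rho j t <= 1.
  case: j => [/hrho0 ->|j]; first by rewrite ler01 lexx.
  by have [_ /(_ t)] := hrho j.+1 isT.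
have k40 : 0 < kappa / 4 by rewrite divr_gt0.
have [del' del'0 rhoU] := uniform_modulus (T + 3) k40 (fun j (_ : (j <= K)%N) => rhoC j).
pose del := Num.min del' (Num.min 1 eps).
have del0 : 0 < del by rewrite !lt_min del'0 ltr01 eps0.
have [deld del1 dele] : [/\ del <= del', del <= 1 & del <= eps].
  by rewrite !ge_min !lexx !orbT.
pose eta := Num.min (kappa / 4) (del * kappa ^+ 2 / 4).
have eta0 : 0 < eta by rewrite lt_min k40 /= divr_gt0// mulr_gt0// exprn_gt0.
have [eta1 eta2] : eta <= kappa / 4 /\ eta <= del * kappa ^+ 2 / 4.
  by rewrite !ge_min !lexx !orbT.
pose r := (Num.truncn (T / del)).+3.
pose s n := (Num.truncn (kappa * n%:R)).+1.
pose H n := (n ^ 6)%N; pose M n := (n ^ 2)%N; pose N n := (r * H n + M n)%N.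
pose h n := del / (H n)%:R.
pose q n := 1 - expR (- (n%:R^-1 * h n)).
pose Z n := arrival_bits (N n) (h n) (X n).
(* Three exceptional sets: [U1] is small by the convergence of the largest components, [U2] is null,
   and [U3] is estimated in the Bernoulli model. *)
pose U1 n := [set om | exists2 j, (0 < j <= K)%N & exists t : R, 0 <= t /\
   `|(C1 (Gkt j (arrival (fun e => X n e om)) t))%:R / n%:R - rho j t| > eta].
pose U2 n := [set om | exists e, X n e om <= 0].
pose U3 n := Z n @^-1` [set` (fun z =>
   ~~ @bits_good R n (N n) (M n) (H n) r K (s n) (q n) eta z) : pred _].
have hU1 : outer_prob_to0 P U1.
  apply: (@outer_prob_to0_exists _ _ _ P K (fun j n => [set om | exists t : R, 0 <= t /\
   `|(C1 (Gkt j (arrival (fun e => X n e om)) t))%:R / n%:R - rho j t| > eta])).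
  by move=> j /andP[j0 _]; have [_ _] := hrho j j0; exact.
have hU2 : outer_prob_to0 P U2.
  apply: (outer_prob_to0_rate (D := 0)); apply: nearW => n.
  (* The slots are countable; [unpickle] enumerates them, so that a countable union of null sets
     covers [U2]. *)
  have : (P n).-negligible (\bigcup_i (if @choice.unpickle (edge n) i is Some e then
      [set om | X n e om <= 0] else set0)).
    apply: negligible_bigcup => i; case: (@choice.unpickle (edge n) i) => [e|]; last exact: negligible_set0.
    exact: prob_nonpositive_gap ((hind n).1 e) (hexp n e).
  move=> [B [mB PB UB]]; exists B; split=> //; last by rewrite PB mul0r.
  apply: subset_trans UB => om [e Xe]; exists (choice.pickle e); first by [].
  by rewrite choice.pickleK.
have hU3 : outer_prob_to0 P U3.
  apply: (outer_prob_to0_rate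
    (D := r.+1%:R * del * (2 + 2 * del + (r.+1 + K * r)%:R / eta ^+ 2))).
  exists 1%N => // n /= n0.
  have h0 : 0 < h n by rewrite divr_gt0// ltr0n expn_gt0 n0.
  have n0R : 0 < n%:R :> R by rewrite ltr0n.
  have H0R : 0 < (H n)%:R :> R by rewrite ltr0n expn_gt0 n0.
  exists (U3 n); split => //.
    exact: (measurable_arrival_bits h0 (hind n)).
  apply: (le_trans (prob_arrival_bits_le h0 (hind n) (hexp n) _)).
  rewrite lee_fin.
  have x0 : 0 <= n%:R^-1 * h n by rewrite mulr_ge0 ?invr_ge0// ltW.
  have /andP[qx1 qx2] := expRN_bounds x0.
  apply: (bprob_not_good_le _ n0 del0 eta0 erefl erefl erefl).
    by rewrite gerBl expR_ge0 andbT subr_ge0 -[leRHS]expR0 ler_expR oppr_le0.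
  apply: (le_trans qx2); rewrite le_eqVlt; apply/orP; left; apply/eqP.
  by rewrite -/(H n) /h; field; rewrite !gt_eqF.
apply: outer_prob_to0_sub (outer_prob_to0U (outer_prob_to0U hU1 hU2) hU3).
(* The second threshold gives [2 / kappa <= n], which absorbs the terms of order [1 / n] into
   [kappa / 2]. *)
exists (maxn 2 (Num.truncn (2 / kappa)).+1) => // n /=.
rewrite geq_max => /andP[n2 nk] om /= [t [tT nclose]].
apply: contrapT => /not_orP[/not_orP[nU1 nU2] nU3]; apply: nclose.
apply: (@edge_count_close R n K r (s n) T eps kappa del eta rho) => //.
- by rewrite (le_trans (ltW (truncnS_gt _)))// ler_nat.
- move=> j u v jK uT vT uv; apply: rhoU => //; exact: le_trans deld.
- by move=> e; rewrite ltNge; apply/negP => Xe; apply: nU2; exists e.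
- move=> j u jK u0; rewrite leNgt; apply/negP => lt; apply: nU1.
  by exists j => //; exists u.
- by apply/negPn/negP => bad; apply: nU3.
Qed.
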